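(* Let $P\subset\mathbb{R}^2$ be an indented region with radius $r_1>0$, and let $r_2>r_1$. Then there is a polygonal region $P_L\subseteq P$ such that $\mathrm{offset}(P,r_2)=\mathrm{offset}(P_L,r_2)$. In particular, $\mathrm{offset}(P,r_2)$ is a bulged region with radius $r_2$.
   Context: For $r\ge 0$, $D_r$ is the closed disk of radius $r$ centered at the origin, and $\mathrm{offset}(X,r):=X\oplus D_r=\{x+v\mid x\in X, v\in D_r\}$ for $X\subseteq\mathbb{R}^2$. A polygonal region is a set $X\subset\mathbb{R}^2$ whose boundary consists of finitely many line segments with disjoint interiors. Let $X\subset\mathbb{R}^2$ be a closed set with some circular arc $\gamma$ on its boundary. The arc $\gamma$ is a dent with respect to $X$ if each line segment connecting two distinct points on $\gamma$ is not fully contained in $X$; otherwise $\gamma$ is a bulge. A closed set $X$ is a bulged (resp. indented) region with radius $r$ if $\partial X$ consists of finitely many straight-line segments and bulges (resp. dents) that are all arcs of circles of radius $r$, interlinked at points called the vertices of the region.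
   Formalization: In indented and bulged regions, every boundary arc is also required to lie in the closure of the interior of the region; without this, a bare half circle of radius r_1 would be an indented region, and it contains no suitable polygonal region. *)

(* Defs.v *)
(* MathComp / MathComp-Analysis *)
From mathcomp Require Import all_boot all_order all_algebra.
From mathcomp Require Import all_classical all_reals all_analysis.
Import numFieldNormedType.Exports.
Import Order.TTheory GRing.Theory Num.Theory.

Set Implicit Arguments.
Unset Strict Implicit.
Unset Printing Implicit Defensive.

Local Open Scope classical_set_scope.
Local Open Scope ring_scope.

(* The plane is R * R.  Its library topology is the usual one, but its library
   norm is the max-norm, hence the explicit Euclidean norm below. *)
Notation plane R := (R * R)%type (only parsing).

Definition euclidean_norm (R : realType) (v : plane R) : R :=
  Num.sqrt (v.1 ^+ 2 + v.2 ^+ 2).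

Definition disk (R : realType) (r : R) : set (plane R) :=
  [set v | euclidean_norm v <= r].

Definition offset (R : realType) (X : set (plane R)) (r : R) : set (plane R) :=
  [set x + v | x in X & v in disk r].

Definition boundary (R : realType) (X : set (plane R)) : set (plane R) :=
  closure X `\` interior X.

Definition segment (R : realType) (p q : plane R) : set (plane R) :=
  [set (1 - t) *: p + t *: q | t in `[0, 1]%classic].

Definition segment_interior (R : realType) (p q : plane R) : set (plane R) :=
  [set (1 - t) *: p + t *: q | t in `]0, 1[%classic].

(* Only the boundary is constrained: the region may be empty or unbounded, and
   may have one-dimensional parts. *)
Definition polygonal_region (R : realType) (X : set (plane R)) : Prop :=
  exists (n : nat) (p q : 'I_n -> plane R),
    [/\ forall i, p i <> q i,
        boundary X = \bigcup_i segment (p i) (q i) &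
        forall i j, i <> j ->
          segment_interior (p i) (q i) `&` segment_interior (p j) (q j)
            = set0].

Definition circle_point (R : realType) (c : plane R) (r t : R) : plane R :=
  (c.1 + r * cos t, c.2 + r * sin t).

Definition arc (R : realType) (c : plane R) (r a b : R) : set (plane R) :=
  [set circle_point c r t | t in `[a, b]%classic].

Definition dent (R : realType) (X gamma : set (plane R)) : Prop :=
  forall p q, gamma p -> gamma q -> p <> q -> ~ (segment p q `<=` X).

Definition bulge (R : realType) (X gamma : set (plane R)) : Prop :=
  ~ dent X gamma.

(* [Arc c a b] is the arc with center [c] from angle [a] to angle [b]
   (counterclockwise); its radius is that of the region it bounds. *)
Inductive edge (R : realType) : Type :=
| Segment of plane R & plane R
| Arc of plane R & R & R.

Definition edge_set (R : realType) (r : R) (e : edge R) : set (plane R) :=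
  match e with
  | Segment p q => segment p q
  | Arc c a b => arc c r a b
  end.

Definition edge_ends (R : realType) (r : R) (e : edge R) : set (plane R) :=
  match e with
  | Segment p q => [set p; q]
  | Arc c a b => [set circle_point c r a; circle_point c r b]
  end.

(* Edges have two distinct endpoints; a full circle has to be split at
   vertices into several arcs. *)
Definition edge_nondegenerate (R : realType) (e : edge R) : Prop :=
  match e with
  | Segment p q => p <> q
  | Arc _ a b => a < b < a + 2 * pi
  end.

(* The closed set [X] is bounded by finitely many segments and arcs of radius
   [r], all arcs being of the given [kind], and any two edges meet only in
   common vertices.  The inclusion in [closure (interior X)] says that an arc
   bounds a two-dimensional part of [X]: it excludes arcs that are
   one-dimensional whiskers of [X], which would be neither concave nor convex
   but satisfy the chord condition of a dent. *)
Definition arc_region (R : realType)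
    (kind : set (plane R) -> set (plane R) -> Prop)
    (r : R) (X : set (plane R)) : Prop :=
  closed X /\
  exists (n : nat) (e : 'I_n -> edge R),
    [/\ forall i, edge_nondegenerate (e i),
        boundary X = \bigcup_i edge_set r (e i),
        forall i j, i <> j ->
          edge_set r (e i) `&` edge_set r (e j)
            `<=` edge_ends r (e i) `&` edge_ends r (e j) &
        forall i c a b, e i = Arc c a b ->
          arc c r a b `<=` closure (interior X) /\ kind X (arc c r a b)].

Definition indented_region (R : realType) (r : R) (X : set (plane R)) : Prop :=
  arc_region (@dent R) r X.

Definition bulged_region (R : realType) (r : R) (X : set (plane R)) : Prop :=
  arc_region (@bulge R) r X.

(* Main.v *)
Require Import Defs.
From mathcomp Require Import all_boot all_order all_algebra.
From mathcomp Require Import all_classical all_reals all_analysis.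
From mathcomp Require Import finmap ring lra.
Import numFieldNormedType.Exports.
Import Order.TTheory GRing.Theory Num.Theory.

(* Near an inner point of a dent the region is exactly the outside of the
   circle: the two sides of the arc cannot both be in the region (the arc is on
   the boundary), nor both be out of it (the arc is in the closure of the
   interior), and the inside being in it would give chords.  Hence a point at
   distance more than [r1] from [P] has no nearest point inside a dent: it would
   lie beyond the center, where sliding along the arc decreases the distance.
   So any subset of [P] that contains the straight edges and the vertices and is
   [(r2 - r1)]-dense in [P] has the same offset.

   Such a subset is obtained by removing from [P] small squares that cover the
   dents, then adding back the straight edges, one small segment of [P] per
   square, and for each end of a dent a segment of [P] that contains it, which
   exists in the direction of the tangent.  The same property of nearest points
   puts the boundary of the offset on finitely many lines parallel to the edges
   and circles of radius [r2] centered at vertices, and the disks bounded by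
   these circles are in the offset, which makes all arcs bulges.

   In both cases the boundary is contained in a finite union of lines and equal
   circles.  Cut at its vertices, such an arrangement has finitely many edges,
   and an open edge is contained in the boundary or disjoint from it, because on
   either side of it the region is everything or nothing; the vertices follow
   since the boundary has no isolated point. *)

Set Implicit Arguments.
Unset Strict Implicit.
Unset Printing Implicit Defensive.

Local Open Scope classical_set_scope.
Local Open Scope ring_scope.

(** * Topology of the plane *)

Section PlaneTopology.
Context {R : realType}.
Implicit Types (x y z p q c v : plane R) (X : set (plane R)).

Lemma nbhs_plane x (N : set (plane R)) :
  nbhs x N <->
  exists2 e : R, 0 < e &
    forall z, `|z.1 - x.1| < e -> `|z.2 - x.2| < e -> N z.
Proof.
split=> [/nbhs_ballP[e e0 H]|[e e0 H]].
  by exists e => // z z1 z2; apply: H; split; rewrite -ball_normE /= distrC.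
apply/nbhs_ballP; exists e => // z [/= z1 z2].
by apply: H; rewrite distrC; [move: z1 | move: z2]; rewrite -ball_normE.
Qed.

Lemma closure_plane X x :
  closure X x <->
  forall e : R, 0 < e ->
    exists z, [/\ X z, `|z.1 - x.1| < e & `|z.2 - x.2| < e].
Proof.
split=> H.
  move=> e e0; have [|z [Xz [z1 z2]]] := H [set z | `|z.1 - x.1| < e /\ `|z.2 - x.2| < e].
    by apply/nbhs_plane; exists e.
  by exists z.
move=> N /nbhs_plane[e e0 He]; have [z [Xz z1 z2]] := H e e0.
by exists z; split => //; apply: He.
Qed.

Lemma segmentP p q z :
  segment p q z <->
  exists2 t : R, 0 <= t <= 1 &
    z = ((1 - t) * p.1 + t * q.1, (1 - t) * p.2 + t * q.2).
Proof.
split=> -[t]; rewrite /= ?in_itv /= => t01.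
  by move=> <-; exists t => //.
by move=> ->; exists t; rewrite /= ?in_itv.
Qed.

Lemma segment_left p q : segment p q p.
Proof.
apply/segmentP; exists 0; first by lra.
by case: p => a b /=; congr pair; ring.
Qed.

Lemma segment_right p q : segment p q q.
Proof.
apply/segmentP; exists 1; first by lra.
by case: q => a b /=; congr pair; ring.
Qed.

Lemma segmentC p q : segment p q = segment q p.
Proof.
have sub (a b : plane R) : segment a b `<=` segment b a.
  move=> z /segmentP[t t01 ->]; apply/segmentP; exists (1 - t); first by lra.
  by congr pair; ring.
by apply/seteqP; split; exact: sub.
Qed.

Lemma affine_dist (a b x e t : R) : 0 <= t <= 1 ->
  `|a - x| < e -> `|b - x| < e -> `|(1 - t) * a + t * b - x| < e.
Proof.
move=> /andP[t0 t1] ae be; pose m := Num.max `|a - x| `|b - x|.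
apply: (@le_lt_trans _ _ m); last by rewrite gt_max ae be.
have : `|a - x| <= m by rewrite le_max lexx.
have : `|b - x| <= m by rewrite le_max lexx orbT.
rewrite !ler_norml => /andP[? ?] /andP[? ?]; apply/andP; split; nra.
Qed.

Lemma segment_square (e : R) x p q z :
  `|p.1 - x.1| < e -> `|p.2 - x.2| < e ->
  `|q.1 - x.1| < e -> `|q.2 - x.2| < e -> segment p q z ->
  `|z.1 - x.1| < e /\ `|z.2 - x.2| < e.
Proof.
move=> ? ? ? ? /segmentP[t t01 -> /=].
by split; apply: affine_dist.
Qed.

Lemma continuous_pair (T : topologicalType) (f g : T -> R) :
  continuous f -> continuous g ->
  continuous (fun t => (f t, g t) : plane R).
Proof. by move=> cf cg t; exact: (cvg_pair (cf t) (cg t)). Qed.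

Lemma continuous_affine (a b : R) : continuous (fun t : R => (1 - t) * a + t * b).
Proof.
move=> t; apply: cvgD; apply: cvgM; do ?[exact: cvg_cst | exact: cvg_id].
by apply: cvgB; [exact: cvg_cst | exact: cvg_id].
Qed.

Lemma segment_image p q :
  segment p q = (fun t : R => ((1 - t) * p.1 + t * q.1,
                               (1 - t) * p.2 + t * q.2) : plane R) @` `[0, 1].
Proof.
apply/seteqP; split => z.
  by move=> /segmentP[t t01 ->]; exists t; rewrite //= in_itv.
by move=> [t /= ]; rewrite in_itv /= => t01 <-; apply/segmentP; exists t.
Qed.

Lemma compact_segment p q : compact (segment p q).
Proof.
rewrite segment_image; apply: continuous_compact; last exact: segment_compact.
by apply: continuous_subspaceT; apply: continuous_pair; exact: continuous_affine.
Qed.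

Lemma plane_hausdorff : hausdorff_space (plane R).
Proof. exact: norm_hausdorff. Qed.

Lemma closed_segment p q : closed (segment p q).
Proof. by apply: compact_closed; [exact: plane_hausdorff|exact: compact_segment]. Qed.

(** On a set that misses the boundary, [X^°] and [closure X] have the same trace, which is therefore
    both open and closed in [A]. *)
Lemma connected_side (A X : set (plane R)) :
  connected A -> A `&` boundary X = set0 -> A `&` X !=set0 -> A `<=` X^°.
Proof.
move=> cA AX0 [x [Ax Xx]].
have E : A `&` X^° = A `&` closure X.
  apply/seteqP; split=> y [Ay Xy]; split=> //.
    exact: (subset_closure (interior_subset Xy)).
  apply: contrapT => nXy; suff : set0 y by [].
  by rewrite -AX0; split.
suff <- : A `&` X^° = A by apply: subIsetr.
apply: cA.
- by exists x; rewrite E; split => //; apply: subset_closure.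
- by exists X^° => //; exact: open_interior.
- by exists (closure X) => //; exact: closed_closure.
Qed.

Lemma segment_side X p q : segment p q `&` boundary X = set0 ->
  X p -> segment p q `<=` X^°.
Proof.
move=> s0 Xp; apply: connected_side => //; last first.
  by exists p; split => //; exact: segment_left.
rewrite segment_image; apply: connected_continuous_connected.
  exact: segment_connected.
by apply: continuous_subspaceT; apply: continuous_pair; exact: continuous_affine.
Qed.

Lemma segment_side_end X p q : segment p q `&` boundary X = set0 ->
  X p -> X q.
Proof.
by move=> s0 /(segment_side s0) H; apply: interior_subset; apply: H; exact: segment_right.
Qed.

Lemma closed_boundary X : closed (boundary X).
Proof.
rewrite /boundary setDE; apply: closedI; first exact: closed_closure.
by apply: open_closedC; exact: open_interior.
Qed.

Lemma boundary_closed X x : closed X -> boundary X x -> X x.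
Proof. by move=> cX [] /cX. Qed.

Lemma in_interior_or_boundary X x : closed X -> X x -> X^° x \/ boundary X x.
Proof.
move=> cX Xx; have [|n] := pselect (X^° x); first by left.
by right; split => //; exact: subset_closure.
Qed.

(* A punctured square is path connected. *)
Lemma boundary_not_isolated X v : closed X ->
  (forall N, nbhs v N -> exists y, [/\ N y, X y & y <> v]) ->
  boundary X v -> forall N, nbhs v N -> exists y, [/\ N y, boundary X y & y <> v].
Proof.
move=> cX perf bv N /nbhs_plane[e e0 Ne]; apply: contrapT => no.
have nob y : `|y.1 - v.1| < e -> `|y.2 - v.2| < e -> y <> v -> ~ boundary X y.
  by move=> y1 y2 yv By; apply: no; exists y; split => //; apply: Ne.
have [x [[x1 x2] Xx xv]] := perf [set y | `|y.1 - v.1| < e /\ `|y.2 - v.2| < e]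
  (ltac:(by apply/nbhs_plane; exists e)).
suff all : forall y, `|y.1 - v.1| < e -> `|y.2 - v.2| < e -> X y.
  by case: bv => _; apply; apply/nbhs_plane; exists e.
have step p q : `|p.1 - v.1| < e -> `|p.2 - v.2| < e ->
    `|q.1 - v.1| < e -> `|q.2 - v.2| < e -> ~ segment p q v -> X p -> X q.
  move=> p1 p2 q1 q2 nv; apply: segment_side_end.
  apply/seteqP; split => // z [sz Bz].
  have [z1 z2] := segment_square p1 p2 q1 q2 sz.
  by apply: nob z1 z2 _ Bz => zv; apply: nv; rewrite -zv.
move=> y y1 y2.
have [->|yv] := pselect (y = v); first exact: boundary_closed bv.
have [sv|] := pselect (segment x y v); last by move/step; apply.
(* Detour when [v] lies between [x] and [y]: [z] is [x] rotated by a quarter turn about [v], which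
   keeps it in the square. *)
pose z : plane R := (v.1 - (x.2 - v.2), v.2 + (x.1 - v.1)).
have z1 : `|z.1 - v.1| < e by rewrite /z /= addrAC subrr add0r normrN.
have z2 : `|z.2 - v.2| < e by rewrite /z /= addrAC subrr add0r.
have D : 0 < (x.1 - v.1) ^+ 2 + (x.2 - v.2) ^+ 2.
  rewrite lt_neqAle eq_sym; apply/andP; split; last first.
    by rewrite addr_ge0 // sqr_ge0.
  rewrite paddr_eq0 ?sqr_ge0 // !sqrf_eq0 !subr_eq0; apply/negP => /andP[/eqP a /eqP b].
  by apply: xv; rewrite [x]surjective_pairing [v]surjective_pairing a b.
(* Since [z - v] is orthogonal to [x - v], a segment from [p] to [z] through [v] would make [p - v]
   orthogonal to [x - v] too. *)
have nz p : (p.1 - v.1) * (x.1 - v.1) + (p.2 - v.2) * (x.2 - v.2) != 0 ->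
    ~ segment p z v.
  move=> pn /segmentP[t _ E].
  have E1 := congr1 fst E; have E2 := congr1 snd E; rewrite /= in E1 E2.
  move: pn D E1 E2; set a := x.1 - v.1; set b := x.2 - v.2.
  move=> pn D E1 E2.
  have F1 : (1 - t) * (p.1 - v.1) = t * b by nra.
  have F2 : (1 - t) * (p.2 - v.2) = - (t * a) by nra.
  have : (1 - t) * ((p.1 - v.1) * a + (p.2 - v.2) * b) = 0.
    by rewrite mulrDr !mulrA F1 F2; ring.
  move/eqP; rewrite mulf_eq0 (negbTE pn) orbF subr_eq0 => /eqP t1.
  by rewrite -t1 subrr !mul0r !mul1r in F1 F2; nra.
have xz : ~ segment x z v by apply: nz; rewrite -!expr2; lra.
apply: (step z) => //; last by apply: (step x).
(* If [y - v] were orthogonal to [x - v] while [v] is on the segment from [x] to [y], then [y] would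
   be [v]. *)
rewrite segmentC; apply: nz; apply/eqP => xy0; apply: yv.
move/segmentP: sv => [t _ E].
have E1 := congr1 fst E; have E2 := congr1 snd E; rewrite /= in E1 E2.
move: xy0 D E1 E2; set a := x.1 - v.1; set b := x.2 - v.2.
move=> xy0 D E1 E2.
have F1 : (1 - t) * a = - (t * (y.1 - v.1)) by rewrite /a; nra.
have F2 : (1 - t) * b = - (t * (y.2 - v.2)) by rewrite /b; nra.
have : (1 - t) * (a ^+ 2 + b ^+ 2) = 0.
  rewrite mulrDr !expr2 !mulrA F1 F2.
  by rewrite -[RHS](mulr0 (- t)) -xy0; ring.
move/eqP; rewrite mulf_eq0 (gt_eqF D) orbF subr_eq0 => /eqP t1.
rewrite -t1 in F1 F2.
by rewrite [y]surjective_pairing [v]surjective_pairing; congr pair; lra.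
Qed.

End PlaneTopology.

(** * Sides of lines and circles *)

(* [Line p d] is the line through [p] with direction [d]; the circles of a
   family all have the same radius, which is passed separately. *)
Inductive curve (R : realType) : Type :=
| Line of plane R & plane R
| Circle of plane R.

Definition curve_eq (R : realType) (r : R) (k : curve R) (z : plane R) : R :=
  match k with
  | Line p d => (z.1 - p.1) * d.2 - (z.2 - p.2) * d.1
  | Circle c => (z.1 - c.1) ^+ 2 + (z.2 - c.2) ^+ 2 - r ^+ 2
  end.

Definition curve_set (R : realType) (r : R) (k : curve R) : set (plane R) :=
  [set z | curve_eq r k z = 0].

Definition curve_wf (R : realType) (k : curve R) : Prop :=
  match k with
  | Line p d => d.1 ^+ 2 + d.2 ^+ 2 != 0
  | Circle c => True
  end.

Section Sides.
Context {R : realType} (r : R).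
Implicit Types (x y z p q c v : plane R) (X N M : set (plane R)) (k : curve R).

Lemma norm_le1_of_sqr (a b : R) : a ^+ 2 + b ^+ 2 = 1 -> `|a| <= 1.
Proof. by move=> E; rewrite ler_norml; apply/andP; split; nra. Qed.

Lemma circle_normal c x : 0 < r -> curve_set r (Circle c) x ->
  exists n : plane R, [/\ n.1 ^+ 2 + n.2 ^+ 2 = 1,
    x = (c.1 + r * n.1, c.2 + r * n.2), `|n.1| <= 1 & `|n.2| <= 1].
Proof.
move=> r0; rewrite /curve_set /= => E.
exists ((x.1 - c.1) / r, (x.2 - c.2) / r) => /=.
have E1 : ((x.1 - c.1) / r) ^+ 2 + ((x.2 - c.2) / r) ^+ 2 = 1.
  rewrite !expr_div_n -mulrDl; apply/eqP.
  by rewrite -subr_eq0 -[X in _ - X](divff (lt0r_neq0 (exprn_gt0 2 r0))) -mulrBl E mul0r.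
split => //; first by case: x {E E1} => a b /=; congr pair; field; exact: lt0r_neq0.
- exact: norm_le1_of_sqr E1.
- by move: E1; rewrite addrC => /norm_le1_of_sqr.
Qed.

Lemma boundary_avoid_segment X N k p q :
  (forall z, N z -> boundary X z -> curve_set r k z) ->
  (forall z, segment p q z -> N z /\ curve_eq r k z != 0) ->
  X p -> X q.
Proof.
move=> NX H; apply: segment_side_end; apply/seteqP; split=> // z [/H[Nz /eqP nz] Bz].
by apply: nz; exact: NX.
Qed.

(** Two nearby points on the same side are joined inside [N] without meeting the curve. A side of a
    line and the inside of a circle are convex; the outside of a circle needs a detour of three
    segments. *)
Lemma side_connected k x X N : 0 < r -> curve_wf k -> curve_set r k x -> nbhs x N ->
  (forall z, N z -> boundary X z -> curve_set r k z) ->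
  exists M, [/\ nbhs x M,
    forall y z, M y -> M z -> 0 < curve_eq r k y -> 0 < curve_eq r k z -> X y -> X z &
    forall y z, M y -> M z -> curve_eq r k y < 0 -> curve_eq r k z < 0 -> X y -> X z].
Proof.
move=> r0 wk kx /nbhs_plane[e e0 Ne] NX.
have seg p q : `|p.1 - x.1| < e -> `|p.2 - x.2| < e ->
    `|q.1 - x.1| < e -> `|q.2 - x.2| < e ->
    (forall z, segment p q z -> curve_eq r k z != 0) -> X p -> X q.
  move=> p1 p2 q1 q2 H; apply: (boundary_avoid_segment NX) => z sz.
  by have [z1 z2] := segment_square p1 p2 q1 q2 sz; split; [exact: Ne|exact: H].
case: k wk kx NX seg => [p d|c] wk kx NX seg.
  exists [set z | `|z.1 - x.1| < e /\ `|z.2 - x.2| < e]; split.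
  - by apply/nbhs_plane; exists e.
  - move=> y z [y1 y2] [z1 z2] /= Fy Fz; apply: seg => // w /segmentP[t /andP[t0 t1] ->].
    rewrite gt_eqF //=.
    have -> : ((1 - t) * y.1 + t * z.1 - p.1) * d.2 - ((1 - t) * y.2 + t * z.2 - p.2) * d.1 =
      (1 - t) * ((y.1 - p.1) * d.2 - (y.2 - p.2) * d.1) +
      t * ((z.1 - p.1) * d.2 - (z.2 - p.2) * d.1) by ring.
    move: Fy Fz; set A := _ - _; set B := _ - _ => Fy Fz; nra.
  - move=> y z [y1 y2] [z1 z2] /= Fy Fz; apply: seg => // w /segmentP[t /andP[t0 t1] ->].
    rewrite lt_eqF //=.
    have -> : ((1 - t) * y.1 + t * z.1 - p.1) * d.2 - ((1 - t) * y.2 + t * z.2 - p.2) * d.1 =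
      (1 - t) * ((y.1 - p.1) * d.2 - (y.2 - p.2) * d.1) +
      t * ((z.1 - p.1) * d.2 - (z.2 - p.2) * d.1) by ring.
    move: Fy Fz; set A := _ - _; set B := _ - _ => Fy Fz; nra.
have [n [n1 xE n11 n21]] := circle_normal r0 kx.
(* [m <= r / 2] makes the scalar product of [w - c] with the normal [n] nonnegative near [x];
   [m <= e / 8] keeps the points shifted by [e / 2] in the square of size [e] and beyond the tangent
   at [x]. *)
pose m := Num.min (r / 2) (e / 8).
have m0 : 0 < m by rewrite lt_min; apply/andP; split; lra.
have mr : m <= r / 2 by rewrite ge_min lexx.
have me : m <= e / 8 by rewrite ge_min lexx orbT.
have dotx z : `|z.1 - x.1| < m -> `|z.2 - x.2| < m ->
    `|(z.1 - x.1) * n.1 + (z.2 - x.2) * n.2| < 2 * m.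
  move=> z1 z2; apply: (le_lt_trans (ler_normD _ _)).
  have := ler_piMr (normr_ge0 (z.1 - x.1)) n11.
  have := ler_piMr (normr_ge0 (z.2 - x.2)) n21.
  by rewrite !normrM; lra.
exists [set z | `|z.1 - x.1| < m /\ `|z.2 - x.2| < m]; split.
- by apply/nbhs_plane; exists m.
- move=> y z [y1 y2] [z1 z2] Fy Fz.
  (* The path goes from [y] outward to [up y], across to [up z], and back to [z]. *)
  pose up (w : plane R) : plane R := (w.1 + e / 2 * n.1, w.2 + e / 2 * n.2).
  have upin w : `|w.1 - x.1| < m -> `|w.2 - x.2| < m ->
      `|(up w).1 - x.1| < e /\ `|(up w).2 - x.2| < e.
    rewrite !ltr_norml /= => /andP[? ?] /andP[? ?].
    move: n11 n21; rewrite !ler_norml => /andP[? ?] /andP[? ?].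
    by split; apply/andP; split; nra.
  have vert w : `|w.1 - x.1| < m -> `|w.2 - x.2| < m -> 0 < curve_eq r (Circle c) w ->
      forall z, segment w (up w) z -> curve_eq r (Circle c) z != 0.
    move=> w1 w2 Fw u /segmentP[t /andP[t0 t1] ->]; rewrite gt_eqF //=.
    have := dotx w w1 w2; rewrite ltr_norml => /andP[lo _].
    move: Fw lo; rewrite /= xE /=.
    set a := w.1 - c.1; set b := w.2 - c.2 => Fw lo.
    have -> : (1 - t) * w.1 + t * (w.1 + e / 2 * n.1) - c.1 = a + t * (e / 2) * n.1.
      by rewrite /a; ring.
    have -> : (1 - t) * w.2 + t * (w.2 + e / 2 * n.2) - c.2 = b + t * (e / 2) * n.2.
      by rewrite /b; ring.
    have dab : 0 <= a * n.1 + b * n.2.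
      have E : (w.1 - (c.1 + r * n.1)) * n.1 + (w.2 - (c.2 + r * n.2)) * n.2 =
         a * n.1 + b * n.2 - r * (n.1 ^+ 2 + n.2 ^+ 2) by rewrite /a /b; ring.
      by rewrite E n1 in lo; lra.
    have -> : (a + t * (e / 2) * n.1) ^+ 2 + (b + t * (e / 2) * n.2) ^+ 2 - r ^+ 2 =
      (a ^+ 2 + b ^+ 2 - r ^+ 2) + t * e * (a * n.1 + b * n.2) +
      (t * (e / 2)) ^+ 2 * (n.1 ^+ 2 + n.2 ^+ 2) by field.
    rewrite n1; have := mulr_ge0 (mulr_ge0 t0 (ltW e0)) dab.
    have := sqr_ge0 (t * (e / 2)); lra.
  have [uy1 uy2] := upin y y1 y2; have [uz1 uz2] := upin z z1 z2.
  have me' : m < e by lra.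
  move=> Xy.
  have Xuy : X (up y).
    by apply: (seg y); rewrite ?(lt_trans y1) ?(lt_trans y2) //; exact: vert.
  have Xuz : X (up z).
    apply: (seg (up y)) => // w /segmentP[t /andP[t0 t1] ->]; rewrite gt_eqF //=.
    have := dotx y y1 y2; rewrite ltr_norml => /andP[ly _].
    have := dotx z z1 z2; rewrite ltr_norml => /andP[lz _].
    set u1 := _ - c.1; set u2 := _ - c.2.
    (* The middle segment lies strictly beyond the tangent at [x]; Cauchy-Schwarz with the unit
       vector [n] then puts it outside the circle. *)
    have : r < u1 * n.1 + u2 * n.2.
      have -> : u1 * n.1 + u2 * n.2 =
        (1 - t) * ((y.1 - x.1) * n.1 + (y.2 - x.2) * n.2) +
        t * ((z.1 - x.1) * n.1 + (z.2 - x.2) * n.2) +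
        (r + e / 2) * (n.1 ^+ 2 + n.2 ^+ 2).
        by rewrite /u1 /u2 xE /=; ring.
      rewrite n1.
      move: ly lz; set A := _ + _; set B := _ + _ => ly lz; nra.
    have : (u1 * n.1 + u2 * n.2) ^+ 2 <= u1 ^+ 2 + u2 ^+ 2.
      rewrite -subr_ge0.
      have -> : u1 ^+ 2 + u2 ^+ 2 - (u1 * n.1 + u2 * n.2) ^+ 2 =
        (u1 ^+ 2 + u2 ^+ 2) * (1 - (n.1 ^+ 2 + n.2 ^+ 2)) + (u1 * n.2 - u2 * n.1) ^+ 2.
        by ring.
      by rewrite n1 subrr mulr0 add0r sqr_ge0.
    set A := u1 * _ + _; nra.
  apply: (seg (up z)); rewrite ?(lt_trans z1) ?(lt_trans z2) //.
  by rewrite segmentC; exact: vert.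
- move=> y z [y1 y2] [z1 z2] Fy Fz.
  have me' : m < e by lra.
  apply: seg; rewrite ?(lt_trans y1) ?(lt_trans y2) ?(lt_trans z1) ?(lt_trans z2) //.
  move=> w /segmentP[t /andP[t0 t1] ->]; rewrite lt_eqF //.
  move: Fy Fz => /=.
  set a := y.1 - c.1; set b := y.2 - c.2; set a' := z.1 - c.1; set b' := z.2 - c.2.
  move=> Fy Fz.
  have -> : (1 - t) * y.1 + t * z.1 - c.1 = (1 - t) * a + t * a' by rewrite /a /a'; ring.
  have -> : (1 - t) * y.2 + t * z.2 - c.2 = (1 - t) * b + t * b' by rewrite /b /b'; ring.
  (* Convexity of the squared distance to [c], with its explicit correction term. *)
  have -> : ((1 - t) * a + t * a') ^+ 2 + ((1 - t) * b + t * b') ^+ 2 - r ^+ 2 =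
    (1 - t) * (a ^+ 2 + b ^+ 2 - r ^+ 2) + t * (a' ^+ 2 + b' ^+ 2 - r ^+ 2)
    - (1 - t) * t * ((a - a') ^+ 2 + (b - b') ^+ 2) by ring.
  have := mulr_ge0 (mulr_ge0 (_ : 0 <= 1 - t) t0) (addr_ge0 (sqr_ge0 (a - a')) (sqr_ge0 (b - b'))).
  move: Fy Fz; set A := _ - r ^+ 2; set B := _ - r ^+ 2; set C := _ * (_ + _).
  by move=> ? ? /(_ ltac:(lra)) ?; nra.
Qed.

Lemma side_limit k x N : 0 < r -> curve_wf k -> curve_set r k x -> nbhs x N ->
  (exists z, N z /\ 0 < curve_eq r k z) /\ (exists z, N z /\ curve_eq r k z < 0).
Proof.
move=> r0 wk kx /nbhs_plane[e e0 Ne]; case: k wk kx => [p d|c] wk kx.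
  rewrite /curve_set /= in wk kx.
  have D : 0 < d.1 ^+ 2 + d.2 ^+ 2 by rewrite lt_neqAle eq_sym wk addr_ge0 ?sqr_ge0.
  have nd s : 0 <= s -> s * (`|d.1| + `|d.2| + 1) < e ->
      `|s * d.2| < e /\ `|s * d.1| < e.
    move=> s0; rewrite !normrM (ger0_norm s0).
    have := normr_ge0 d.1; have := normr_ge0 d.2; nra.
  pose s := e / 2 / (`|d.1| + `|d.2| + 1).
  have n0 : 0 < `|d.1| + `|d.2| + 1 by rewrite ltr_wpDl ?addr_ge0.
  have s0 : 0 < s by rewrite !divr_gt0.
  have [] := nd s (ltW s0); first by rewrite divfK ?gt_eqF //; lra.
  move=> s2 s1; split.
    exists (x.1 + s * d.2, x.2 - s * d.1); split.
      by apply: Ne => /=; rewrite addrAC subrr add0r ?normrN.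
    rewrite /=; have -> : (x.1 + s * d.2 - p.1) * d.2 - (x.2 - s * d.1 - p.2) * d.1 =
      ((x.1 - p.1) * d.2 - (x.2 - p.2) * d.1) + s * (d.1 ^+ 2 + d.2 ^+ 2) by ring.
    by rewrite kx add0r mulr_gt0.
  exists (x.1 - s * d.2, x.2 + s * d.1); split.
    by apply: Ne => /=; rewrite addrAC subrr add0r ?normrN.
  rewrite /=; have -> : (x.1 - s * d.2 - p.1) * d.2 - (x.2 + s * d.1 - p.2) * d.1 =
    ((x.1 - p.1) * d.2 - (x.2 - p.2) * d.1) - s * (d.1 ^+ 2 + d.2 ^+ 2) by ring.
  by rewrite kx add0r oppr_lt0 mulr_gt0.
have [n [n1 xE n11 n21]] := circle_normal r0 kx.
(* The cap [r] gives [(r - s) ^+ 2 < r ^+ 2] for the inward step. *)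
pose s := Num.min (e / 2) r.
have s0 : 0 < s by rewrite lt_min r0 andbT; lra.
have se : s <= e / 2 by rewrite ge_min lexx.
have sr : s <= r by rewrite ge_min lexx orbT.
have sn (a : R) : `|a| <= 1 -> `|s * a| < e.
  by move=> a1; rewrite normrM (gtr0_norm s0); nra.
split.
  exists (x.1 + s * n.1, x.2 + s * n.2); split.
    by apply: Ne => /=; rewrite addrAC subrr add0r sn.
  rewrite xE /=.
  have -> : (c.1 + r * n.1 + s * n.1 - c.1) ^+ 2 + (c.2 + r * n.2 + s * n.2 - c.2) ^+ 2 - r ^+ 2
     = (r + s) ^+ 2 * (n.1 ^+ 2 + n.2 ^+ 2) - r ^+ 2 by ring.
  by rewrite n1; nra.
exists (x.1 - s * n.1, x.2 - s * n.2); split.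
  by apply: Ne => /=; rewrite addrAC subrr add0r normrN sn.
rewrite xE /=.
have -> : (c.1 + r * n.1 - s * n.1 - c.1) ^+ 2 + (c.2 + r * n.2 - s * n.2 - c.2) ^+ 2 - r ^+ 2
   = (r - s) ^+ 2 * (n.1 ^+ 2 + n.2 ^+ 2) - r ^+ 2 by ring.
by rewrite n1; nra.
Qed.

Lemma side_dichotomy k x X N : 0 < r -> curve_wf k -> curve_set r k x -> nbhs x N ->
  (forall z, N z -> boundary X z -> curve_set r k z) ->
  exists M, [/\ open M, M x,
    (forall z, M z -> 0 < curve_eq r k z -> X z) \/
    (forall z, M z -> 0 < curve_eq r k z -> ~ X z) &
    (forall z, M z -> curve_eq r k z < 0 -> X z) \/
    (forall z, M z -> curve_eq r k z < 0 -> ~ X z)].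
Proof.
move=> r0 wk kx Nx NX; have [M [Mx Mp Mn]] := side_connected r0 wk kx Nx NX.
exists M^°; split; [exact: open_interior|exact: Mx| |].
  have [[z [Mz Fz Xz]]|no] := pselect (exists z, [/\ M z, 0 < curve_eq r k z & X z]).
    by left=> y /interior_subset My Fy; exact: (Mp z).
  by right=> y /interior_subset My Fy Xy; apply: no; exists y.
have [[z [Mz Fz Xz]]|no] := pselect (exists z, [/\ M z, curve_eq r k z < 0 & X z]).
  by left=> y /interior_subset My Fy; exact: (Mn z).
by right=> y /interior_subset My Fy Xy; apply: no; exists y.
Qed.

(** A point of [M] on the curve is a limit of points on the positive side, so closedness of [X]
    fills in the curve. *)
Lemma both_sides_in k x X M : 0 < r -> curve_wf k -> open M -> M x -> closed X ->
  (forall z, M z -> 0 < curve_eq r k z -> X z) ->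
  (forall z, M z -> curve_eq r k z < 0 -> X z) -> X^° x.
Proof.
move=> r0 wk oM Mx cX Mp Mn; suff MX : M `<=` X.
  by apply: (filterS MX); exact: open_nbhs_nbhs.
move=> z Mz; have [Fz|Fz|Fz] := ltgtP 0 (curve_eq r k z); [exact: Mp|exact: Mn|].
apply: cX => N Nz.
have MN : nbhs z (M `&` N) by apply: filterI => //; exact: open_nbhs_nbhs.
have [[y [[My Ny] Fy]] _] := side_limit r0 wk (esym Fz : curve_set r k z) MN.
by exists y; split => //; exact: Mp.
Qed.

(** An interior point of [X] on the curve would have points of [X] beside the curve, so [X] has no
    interior in [M]. *)
Lemma both_sides_out k x X M : 0 < r -> curve_wf k -> open M -> M x -> 
  (forall z, M z -> 0 < curve_eq r k z -> ~ X z) ->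
  (forall z, M z -> curve_eq r k z < 0 -> ~ X z) -> ~ closure X^° x.
Proof.
move=> r0 wk oM Mx Mp Mn /(_ M (open_nbhs_nbhs (conj oM Mx)))[z [iz Mz]].
have [Fz|Fz|Fz] := ltgtP 0 (curve_eq r k z).
- exact: (Mp z Mz Fz (interior_subset iz)).
- exact: (Mn z Mz Fz (interior_subset iz)).
have MN : nbhs z (M `&` X^°).
  by apply: filterI; apply: open_nbhs_nbhs; split => //; exact: open_interior.
have [[y [[My iy] Fy]] _] := side_limit r0 wk (esym Fz : curve_set r k z) MN.
by exact: (Mp y My Fy (interior_subset iy)).
Qed.

Lemma sides_boundary k x X M : 0 < r -> curve_wf k -> open M -> M x -> curve_set r k x ->
  ((forall z, M z -> 0 < curve_eq r k z -> X z) /\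
   (forall z, M z -> curve_eq r k z < 0 -> ~ X z)) \/
  ((forall z, M z -> 0 < curve_eq r k z -> ~ X z) /\
   (forall z, M z -> curve_eq r k z < 0 -> X z)) -> boundary X x.
Proof.
move=> r0 wk oM Mx kx H; have nM : nbhs x M by exact: open_nbhs_nbhs.
split.
  move=> N Nx; have [[y [[My Ny] Fy]] [z [[Mz Nz] Fz]]] := side_limit r0 wk kx (filterI nM Nx).
  by case: H => -[Hp Hn]; [exists y|exists z]; split => //; [exact: Hp|exact: Hn].
move=> ix; have nI : nbhs x X^° by apply: open_nbhs_nbhs; split => //; exact: open_interior.
have [[y [[My Ny] Fy]] [z [[Mz Nz] Fz]]] := side_limit r0 wk kx (filterI nM nI).
by case: H => -[Hp Hn]; [apply: (Hn z)|apply: (Hp y)] => //; exact: interior_subset.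
Qed.

End Sides.

(** * Parametrizations and intersections of lines and circles *)

Definition curve_at (R : realType) (r : R) (k : curve R) (t : R) : plane R :=
  match k with
  | Line p d => (p.1 + t * d.1, p.2 + t * d.2)
  | Circle c => circle_point c r t
  end.

Section CurveParam.
Context {R : realType} (r : R).
Implicit Types (x y z p q c v : plane R) (X N M : set (plane R)) (k l : curve R).

Lemma curve_at_continuous k : continuous (curve_at r k).
Proof.
case: k => [p d|c]; apply: continuous_pair => t; apply: cvgD; do ?exact: cvg_cst.
- by apply: cvgM; [exact: cvg_id|exact: cvg_cst].
- by apply: cvgM; [exact: cvg_id|exact: cvg_cst].
- by apply: cvgM; [exact: cvg_cst|exact: continuous_cos].
- by apply: cvgM; [exact: cvg_cst|exact: continuous_sin].
Qed.

Lemma curve_at_in k t : curve_set r k (curve_at r k t).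
Proof.
case: k => [p d|c]; rewrite /curve_set /=; first by ring.
have := cos2Dsin2 t; set a := cos t; set b := sin t => E.
have -> : (c.1 + r * a - c.1) ^+ 2 + (c.2 + r * b - c.2) ^+ 2 - r ^+ 2 =
  r ^+ 2 * (a ^+ 2 + b ^+ 2) - r ^+ 2 by ring.
by rewrite E mulr1 subrr.
Qed.

Lemma curve_eq_continuous k : continuous (curve_eq r k).
Proof.
have c1 a : continuous (fun z : plane R => z.1 - a).
  by move=> z; apply: cvgB; [exact: cvg_fst|exact: cvg_cst].
have c2 a : continuous (fun z : plane R => z.2 - a).
  by move=> z; apply: cvgB; [exact: cvg_snd|exact: cvg_cst].
case: k => [p d|c] z.
  by apply: cvgB; apply: cvgM; do ?[exact: cvg_cst|exact: c1|exact: c2].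
apply: cvgB; last exact: cvg_cst.
by apply: cvgD; apply: cvgM; do ?[exact: c1|exact: c2].
Qed.

Lemma closed_curve k : closed (curve_set r k).
Proof.
have -> : curve_set r k = curve_eq r k @^-1` [set 0] by [].
by apply: closed_comp; [move=> z _; exact: curve_eq_continuous|exact: closed_eq].
Qed.

Lemma line_at_inj p d t u : curve_wf (Line p d) ->
  curve_at r (Line p d) t = curve_at r (Line p d) u -> t = u.
Proof.
move=> /= wk [/addrI E1 /addrI E2]; apply/eqP; rewrite -subr_eq0.
have : (t - u) * (d.1 ^+ 2 + d.2 ^+ 2) = 0.
  have -> : (t - u) * (d.1 ^+ 2 + d.2 ^+ 2) = (t * d.1 - u * d.1) * d.1 + (t * d.2 - u * d.2) * d.2 by ring.
  by rewrite E1 E2; ring.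
by move/eqP; rewrite mulf_eq0 (negbTE wk) orbF.
Qed.

Lemma line_at_surj p d z : curve_wf (Line p d) -> curve_set r (Line p d) z ->
  exists t, z = curve_at r (Line p d) t.
Proof.
rewrite /curve_set /= => wk E.
exists (((z.1 - p.1) * d.1 + (z.2 - p.2) * d.2) / (d.1 ^+ 2 + d.2 ^+ 2)).
rewrite [LHS]surjective_pairing.
have E2 : (z.2 - p.2) * d.1 = (z.1 - p.1) * d.2 by lra.
congr pair; rewrite mulrAC mulrDl -!mulrA.
- have -> : (z.1 - p.1) * (d.1 * d.1) + (z.2 - p.2) * (d.2 * d.1) =
    (z.1 - p.1) * (d.1 ^+ 2 + d.2 ^+ 2).
    by rewrite (mulrC d.2) (mulrA (z.2 - p.2)) E2; ring.
  by rewrite mulfK //; ring.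
- have -> : (z.1 - p.1) * (d.1 * d.2) + (z.2 - p.2) * (d.2 * d.2) =
    (z.2 - p.2) * (d.1 ^+ 2 + d.2 ^+ 2).
    by rewrite (mulrC d.1) (mulrA (z.1 - p.1)) -E2; ring.
  by rewrite mulfK //; ring.
Qed.

(** Equal points give [cos (t - u) = 1], hence a zero of the sine at the half angle; but for [u < t]
    the half angle is strictly between 0 and [pi], where the sine is positive. *)
Lemma circle_point_inj c t u : 0 < r -> `|t - u| < 2 * pi ->
  circle_point c r t = circle_point c r u -> t = u.
Proof.
move=> r0 tu [/addrI /(mulfI (lt0r_neq0 r0)) E1 /addrI /(mulfI (lt0r_neq0 r0)) E2].
wlog le : t u tu E1 E2 / u <= t.
  move=> H; have [|/ltW tu'] := leP u t; first exact: H.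
  by apply/esym/H => //; rewrite distrC.
apply/eqP; rewrite eq_le le andbT leNgt; apply/negP => lt.
have s0 : 0 < sin ((t - u) / 2).
  apply: sin_gt0_pi; move: tu; rewrite ger0_norm ?subr_ge0 //; lra.
have : cos (t - u) = 1 by rewrite cosB E1 E2 -!expr2 cos2Dsin2.
have {1}-> : t - u = (t - u) / 2 *+ 2 by rewrite mulr2n; field.
rewrite cos_mulr2n => E.
have := cos2Dsin2 ((t - u) / 2); move: s0 E.
set a := sin _; set b := cos _; rewrite mulr2n; nra.
Qed.

Lemma circle_point_surj c z : 0 < r -> curve_set r (Circle c) z ->
  exists2 t, 0 <= t < 2 * pi & z = circle_point c r t.
Proof.
move=> r0 /(circle_normal r0)[n [E -> n1 _]].
have n1' : -1 <= n.1 <= 1 by move: n1; rewrite ler_norml.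
have nin : n.1 \in `[-1, 1] by rewrite in_itv.
have := acos_ge0 n1'; have := acos_lepi n1'; have := pi_gt0 R => pi0 alepi a0.
have sE : sin (acos n.1) = `|n.2|.
  by rewrite sin_acos // -E addrAC subrr add0r sqrtr_sqr.
have [n2|n2] := leP 0 n.2.
  exists (acos n.1); first by lra.
  by rewrite /circle_point acosK // sE ger0_norm.
(* A point strictly below the horizontal diameter has a nonzero angle, which keeps
   [2 * pi - acos n.1] below [2 * pi]. *)
have a1 : 0 < acos n.1.
  rewrite lt_neqAle a0 andbT; apply/eqP => a00; move: sE; rewrite -a00 sin0.
  by rewrite ltr0_norm //; lra.
exists (2 * pi - acos n.1); first by lra.
rewrite /circle_point.
have -> : 2 * pi - acos n.1 = - acos n.1 + pi *+ 2 by rewrite mulr2n; ring.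
by rewrite cosD2pi sinD2pi cosN sinN acosK // sE ltr0_norm // opprK.
Qed.

(** By Vieta, one root determines the other. *)
Lemma finite_quadratic (a b e : R) : a != 0 ->
  finite_set [set t | a * t ^+ 2 + b * t + e = 0].
Proof.
move=> a0; have [[s Es]|no] := pselect (exists s, a * s ^+ 2 + b * s + e = 0).
  apply: (@sub_finite_set _ _ [set s; - (b / a) - s]); last exact: finite_set2.
  move=> t /= Et; have [->|/eqP ts] := pselect (t = s); first by left.
  right; apply: (mulfI a0); rewrite mulrBr mulrN mulrCA divff // mulr1.
  have : (t - s) * (a * (t + s) + b) = 0.
    by rewrite -[RHS](subrr 0) -{1}Et -Es; ring.
  by move/eqP; rewrite mulf_eq0 subr_eq0 (negbTE ts) /= => /eqP ?; lra.
by apply: (@sub_finite_set _ _ set0) => // t Et; apply: no; exists t.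
Qed.

Lemma finite_line_circle p d c : curve_wf (Line p d) ->
  finite_set (curve_set r (Line p d) `&` curve_set r (Circle c)).
Proof.
move=> wk; set a := d.1 ^+ 2 + d.2 ^+ 2.
pose b := (p.1 - c.1) * d.1 *+ 2 + (p.2 - c.2) * d.2 *+ 2.
pose e := (p.1 - c.1) ^+ 2 + (p.2 - c.2) ^+ 2 - r ^+ 2.
apply: (@sub_finite_set _ _ (curve_at r (Line p d) @` [set t | a * t ^+ 2 + b * t + e = 0])).
  move=> z [/(line_at_surj wk)[t ->] E]; exists t => //; move: E.
  by rewrite /curve_set /= => <-; rewrite /a /b /e; ring.
by apply: finite_image; exact: finite_quadratic.
Qed.

(** Distinct lines through a common point are not parallel. Distinct circles of equal radius meet
    only on the perpendicular bisector of their centers, which reduces them to a line and a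
    circle. *)
Lemma finite_curveI k l : curve_wf k -> curve_wf l ->
  curve_set r k <> curve_set r l -> finite_set (curve_set r k `&` curve_set r l).
Proof.
case: k l => [p d|c] [q f|c'] wk wl kl.
- have [[x [kx lx]]|no] := pselect (exists x, curve_set r (Line p d) x /\ curve_set r (Line q f) x); last first.
    by apply: (@sub_finite_set _ _ set0) => // x kx; apply: no; exists x.
  have D : d.1 * f.2 - d.2 * f.1 != 0.
    apply/eqP => D; apply: kl; move: wk wl kx lx; rewrite /curve_set /=.
    move=> wk wl kx lx; apply/seteqP; split => z /= zE.
    + have U : (z.1 - x.1) * d.2 = (z.2 - x.2) * d.1 by lra.
      have : ((z.1 - x.1) * f.2 - (z.2 - x.2) * f.1) * (d.1 ^+ 2 + d.2 ^+ 2) = 0.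
        have -> : ((z.1 - x.1) * f.2 - (z.2 - x.2) * f.1) * (d.1 ^+ 2 + d.2 ^+ 2) =
          ((z.1 - x.1) * d.1 + (z.2 - x.2) * d.2) * (d.1 * f.2 - d.2 * f.1)
          + (d.1 * f.1 + d.2 * f.2) * ((z.1 - x.1) * d.2 - (z.2 - x.2) * d.1) by ring.
        by rewrite D U subrr !mulr0 addr0.
      by move/eqP; rewrite mulf_eq0 (negbTE wk) orbF => /eqP; lra.
    + have U : (z.1 - x.1) * f.2 = (z.2 - x.2) * f.1 by lra.
      have : ((z.1 - x.1) * d.2 - (z.2 - x.2) * d.1) * (f.1 ^+ 2 + f.2 ^+ 2) = 0.
        have -> : ((z.1 - x.1) * d.2 - (z.2 - x.2) * d.1) * (f.1 ^+ 2 + f.2 ^+ 2) =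
          - ((z.1 - x.1) * f.1 + (z.2 - x.2) * f.2) * (d.1 * f.2 - d.2 * f.1)
          + (d.1 * f.1 + d.2 * f.2) * ((z.1 - x.1) * f.2 - (z.2 - x.2) * f.1) by ring.
        by rewrite D U subrr !mulr0 addr0.
      by move/eqP; rewrite mulf_eq0 (negbTE wl) orbF => /eqP; lra.
  apply: (@sub_finite_set _ _ [set x]); last exact: finite_set1.
  move: kx lx; rewrite /curve_set /= => kx lx z [/= kz lz].
  have U : (z.1 - x.1) * d.2 - (z.2 - x.2) * d.1 = 0 by lra.
  have V : (z.1 - x.1) * f.2 - (z.2 - x.2) * f.1 = 0 by lra.
  have : (z.1 - x.1) * (d.1 * f.2 - d.2 * f.1) = 0.
    transitivity (d.1 * ((z.1 - x.1) * f.2 - (z.2 - x.2) * f.1) - f.1 * ((z.1 - x.1) * d.2 - (z.2 - x.2) * d.1)).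
      by ring.
    by rewrite U V; ring.
  have : (z.2 - x.2) * (d.1 * f.2 - d.2 * f.1) = 0.
    transitivity (d.2 * ((z.1 - x.1) * f.2 - (z.2 - x.2) * f.1) - f.2 * ((z.1 - x.1) * d.2 - (z.2 - x.2) * d.1)).
      by ring.
    by rewrite U V; ring.
  move=> /eqP; rewrite mulf_eq0 (negbTE D) orbF subr_eq0 => /eqP z2.
  move=> /eqP; rewrite mulf_eq0 (negbTE D) orbF subr_eq0 => /eqP z1.
  by rewrite [z]surjective_pairing [x]surjective_pairing z1 z2.
- exact: finite_line_circle.
- by rewrite setIC; exact: finite_line_circle.
- pose p : plane R := ((c.1 + c'.1) / 2, (c.2 + c'.2) / 2).
  pose d : plane R := (c.2 - c'.2, c'.1 - c.1).
  have wd : curve_wf (Line p d).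
    rewrite /= paddr_eq0 ?sqr_ge0 // !sqrf_eq0 !subr_eq0; apply/negP => /andP[/eqP e2 /eqP e1].
    by apply: kl; rewrite [c]surjective_pairing [c']surjective_pairing e1 e2.
  apply: (sub_finite_set _ (finite_line_circle c wd)) => z [kz lz]; split=> //.
  move: kz lz; rewrite /curve_set /= => kz lz; nra.
Qed.

End CurveParam.

(** * Arrangements of lines and circles *)

Lemma finite_enum (T : Type) (A : set T) : finite_set A ->
  exists n (f : 'I_n -> T), (forall i j, f i = f j -> i = j) /\ A = range f.
Proof.
move=> /finite_setP[n /card_set_bijP[g [gfun ginj gsurj]]].
have pre (i : 'I_n) : exists x, A x /\ g x = i.
  by have [x Ax gx] := gsurj i (ltn_ord i); exists x.
have [f fP] := choice pre.
exists n, f; split.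
  by move=> i j ij; apply: val_inj; rewrite /= -(fP i).2 -(fP j).2 ij.
apply/seteqP; split=> [x Ax|_ [i _ <-]]; last by have [] := fP i.
exists (Ordinal (gfun x Ax)) => //; have [Af gf] := fP (Ordinal (gfun x Ax)).
by apply: ginj => //; exact: mem_set.
Qed.

Lemma closed_bigcup_finite (T : topologicalType) (I : Type) (A : set I)
    (F : I -> set T) :
  finite_set A -> (forall i, A i -> closed (F i)) -> closed (\bigcup_(i in A) F i).
Proof.
move=> /finite_enum[n [f [_ ->]]] cF.
have -> : \bigcup_(i in range f) F i = \bigcup_(i in [set: 'I_n]) F (f i).
  apply/seteqP; split=> [x [_ [i _ <-] Fx]|x [i _ Fx]]; first by exists i.
  by exists (f i) => //; exists i.
by apply: closed_bigcup => [|i _]; [exact: finite_finset|apply: cF; exists i].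
Qed.

Lemma closed_finite (T : topologicalType) (A : set T) :
  hausdorff_space T -> finite_set A -> closed A.
Proof.
by move=> hT; exact: (accessible_finite_set_closed.1 (hausdorff_accessible hT)).
Qed.

Lemma finite_max (R : realType) (A : set R) : finite_set A -> A !=set0 ->
  exists a, A a /\ forall b, A b -> b <= a.
Proof.
move=> /finite_seqP[s ->]; elim: s => [|x s IH] [y]; first by [].
move=> _; have [[z zs]|no] := pselect ([set` s] !=set0); last first.
  exists x; split; first by rewrite /= inE eqxx.
  move=> b; rewrite /= inE => /orP[/eqP ->//|bs]; exfalso; apply: no; by exists b.
have [|a [/= as_ amax]] := IH; first by exists z.
exists (Num.max x a); split.
  by rewrite /= inE; case: (leP x a) => _; rewrite ?eqxx ?as_ ?orbT.
move=> b; rewrite /= inE le_max => /orP[/eqP ->|/amax ->]; by rewrite ?lexx ?orbT.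
Qed.

Lemma finite_min (R : realType) (A : set R) : finite_set A -> A !=set0 ->
  exists a, A a /\ forall b, A b -> a <= b.
Proof.
move=> fA [x Ax]; have [|a [[b Ab <-] amax]] := finite_max (finite_image -%R fA).
  by exists (- x), x.
by exists b; split => // c Ac; rewrite -lerN2; apply: amax; exists c.
Qed.

Section Arrangement.
Context {R : realType} (r : R).
Implicit Types (x y z p q c v : plane R) (X N M : set (plane R)) (k l : curve R).

Lemma compact_curve_part k (a b : R) : compact (curve_at r k @` `[a, b]).
Proof.
apply: continuous_compact; last exact: segment_compact.
by apply: continuous_subspaceT; exact: curve_at_continuous.
Qed.

Lemma closed_curve_part k (a b : R) : closed (curve_at r k @` `[a, b]).
Proof.
by apply: compact_closed; [exact: plane_hausdorff|exact: compact_curve_part].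
Qed.

Definition curve_edge k (a b : R) : edge R :=
  match k with
  | Line p d => Segment (curve_at r k a) (curve_at r k b)
  | Circle c => Arc c a b
  end.

Lemma curve_edge_set k (a b : R) : a < b ->
  edge_set r (curve_edge k a b) = curve_at r k @` `[a, b].
Proof.
case: k => [p d|c] ab //=; apply/seteqP; split=> z.
  move/segmentP=> [t t01 ->]; exists ((1 - t) * a + t * b); last by congr pair => /=; ring.
  by rewrite /= in_itv /=; apply/andP; split; nra.
move=> [t /=]; rewrite in_itv /= => /andP[t1 t2] <-; apply/segmentP => /=.
have ba : b - a != 0 by rewrite subr_eq0 gt_eqF.
exists ((t - a) / (b - a)); last by congr pair; field.
by rewrite divr_ge0 ?subr_ge0 ?(ltW ab) //= ler_pdivrMr ?subr_gt0 // mul1r lerD2r.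
Qed.

Lemma curve_edge_ends k (a b : R) :
  edge_ends r (curve_edge k a b) = [set curve_at r k a; curve_at r k b].
Proof. by case: k. Qed.

(* The parameter interval of a curve: a full turn of a circle, and a part of a
   line that contains its points with coordinates bounded by [m]. *)
Definition param_bound (m : R) p d : R :=
  ((m + `|p.1|) * `|d.1| + (m + `|p.2|) * `|d.2|) / (d.1 ^+ 2 + d.2 ^+ 2) + 1.

Definition param_lo (m : R) k : R :=
  match k with Line p d => - param_bound m p d | Circle _ => 0 end.

Definition param_hi (m : R) k : R :=
  match k with Line p d => param_bound m p d | Circle _ => 2 * pi end.

(** For a circle, the extra vertex at angle [pi] prevents a full turn from becoming a single edge,
    which [edge_nondegenerate] forbids. *)
Definition param_mid (m : R) k : R :=
  match k with Line p d => 0 | Circle _ => pi end.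

Lemma param_surj m k z : 0 < r -> 0 <= m -> curve_wf k -> curve_set r k z ->
  `|z.1| <= m -> `|z.2| <= m ->
  exists2 t, param_lo m k <= t <= param_hi m k & z = curve_at r k t.
Proof.
move=> r0 m0; case: k => [p d|c] wk kz z1 z2; last first.
  by have [t t01 zE] := circle_point_surj r0 kz; exists t => //=; lra.
have [t zE] := line_at_surj wk kz; exists t => //; rewrite -ler_norml.
have D : 0 < d.1 ^+ 2 + d.2 ^+ 2 by rewrite lt_neqAle eq_sym wk addr_ge0 ?sqr_ge0.
rewrite /param_bound; apply: ler_wpDr => //; rewrite ler_pdivlMr //.
have -> : `|t| * (d.1 ^+ 2 + d.2 ^+ 2) = `|(z.1 - p.1) * d.1 + (z.2 - p.2) * d.2|.
  rewrite -{1}(gtr0_norm D) -normrM; congr (`|_|).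
  by rewrite zE /=; ring.
apply: (le_trans (ler_normD _ _)); rewrite !normrM.
apply: lerD; apply: ler_wpM2r => //; apply: (le_trans (ler_normB _ _)).
  by rewrite lerD2r.
by rewrite lerD2r.
Qed.

(** As [t] lies strictly inside, the two ends of a full turn, which are the same point, cannot be
    confused. *)
Lemma param_inj m k t u : 0 < r -> curve_wf k ->
  param_lo m k < t < param_hi m k -> param_lo m k <= u <= param_hi m k ->
  curve_at r k t = curve_at r k u -> t = u.
Proof.
move=> r0; case: k => [p d|c] wk; first by move=> _ _; exact: line_at_inj.
move=> /= t01 u01; apply: (circle_point_inj r0).
rewrite ltr_norml; lra.
Qed.

End Arrangement.

Section ArrangementTheorem.
Context {R : realType} (r : R).
Implicit Types (x y z p q c v : plane R) (X N M : set (plane R)) (k l : curve R).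
Implicit Types (K : set (curve R)).

(** One line has many presentations [Line p d]; with one curve kept per point set, distinct curves
    meet in finitely many points. *)
Lemma distinct_curves K : finite_set K -> exists K',
  [/\ finite_set K', K' `<=` K,
      forall k, K k -> exists2 l, K' l & curve_set r l = curve_set r k &
      forall k l, K' k -> K' l -> curve_set r k = curve_set r l -> k = l].
Proof.
move=> fK.
have pre (s : set (plane R)) : exists k, (exists l, K l /\ curve_set r l = s) ->
    K k /\ curve_set r k = s.
  have [[l Hl]|no] := pselect (exists l, K l /\ curve_set r l = s); first by exists l.
  (* [Circle 0] is a default for the point sets that belong to no curve of [K]. *)
  by exists (Circle 0) => /no.
have [f fP] := choice pre.
exists (f @` (curve_set r @` K)); split.
- by do 2! apply: finite_image.
- move=> _ [_ [k Kk <-] <-]; by have [] := fP (curve_set r k) (ltac:(by exists k)).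
- move=> k Kk; exists (f (curve_set r k)).
    by exists (curve_set r k) => //; exists k.
  by have [] := fP (curve_set r k) (ltac:(by exists k)).
- move=> _ _ [_ [k Kk <-] <-] [_ [l Kl <-] <-].
  have [_ ->] := fP (curve_set r k) (ltac:(by exists k)).
  by have [_ ->] := fP (curve_set r l) (ltac:(by exists l)); move=> ->.
Qed.

(* At a boundary point on a single curve, either the two sides of the curve
   differ, or [X] is thin and contains a piece of the curve. *)
Lemma boundary_along_curve X N k x : 0 < r -> closed X -> curve_wf k ->
  curve_set r k x -> boundary X x -> nbhs x N ->
  (forall z, N z -> boundary X z -> curve_set r k z) ->
  closure X^° x \/ (exists2 N', nbhs x N' & N' `&` curve_set r k `<=` X) ->
  exists2 M, nbhs x M & M `&` curve_set r k `<=` boundary X.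
Proof.
move=> r0 cX wk kx bx Nx NX thin.
have [M [oM Mx Mp Mn]] := side_dichotomy r0 wk kx Nx NX.
have nM : nbhs x M by exact: open_nbhs_nbhs.
case: Mp Mn => Mp [] Mn.
- by case: bx => _; case; exact: (both_sides_in r0 wk oM Mx cX Mp Mn).
- exists M => // y [My ky]; apply: (sides_boundary r0 wk oM My ky); by left.
- exists M => // y [My ky]; apply: (sides_boundary r0 wk oM My ky); by right.
- case: thin => [|[N' N'x N'X]]; first by move/(both_sides_out r0 wk oM Mx Mp Mn).
  exists (M `&` N'); first exact: filterI.
  move=> y [[My N'y] ky]; have Xy : X y by exact: N'X.
  have [iy|//] := in_interior_or_boundary cX Xy.
  by case: (both_sides_out r0 wk oM My Mp Mn); exact: subset_closure.
Qed.

Definition consecutive (V : set (plane R)) (m : R) k (a b : R) : Prop :=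
  [/\ param_lo m k <= a /\ b <= param_hi m k, a < b,
      V (curve_at r k a), V (curve_at r k b) &
      forall t, a < t < b -> ~ V (curve_at r k t)].

(** Common core of both conclusions of the theorem. The first condition on neighborhoods excludes
    isolated points. The last one treats one-dimensional pieces of [X]: they must follow curves of
    [K], except at the finitely many points of [W], such as their ends. *)
Lemma arrangement X K (W : set (plane R)) (m : R) :
  0 < r -> closed X ->
  (forall x N, X x -> nbhs x N -> exists y, [/\ N y, X y & y <> x]) ->
  finite_set K -> (forall k, K k -> curve_wf k) ->
  (forall x, boundary X x -> exists2 k, K k & curve_set r k x) ->
  0 <= m -> (forall x, boundary X x -> `|x.1| <= m /\ `|x.2| <= m) ->
  finite_set W ->
  (forall x, boundary X x -> ~ W x ->
    closure X^° x \/ exists2 k, K k /\ curve_set r k x &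
      exists2 N, nbhs x N & N `&` curve_set r k `<=` X) ->
  exists (n : nat) (e : 'I_n -> edge R),
    [/\ forall i, edge_nondegenerate (e i),
        boundary X = \bigcup_i edge_set r (e i),
        forall i j, i <> j ->
          edge_set r (e i) `&` edge_set r (e j)
            `<=` edge_ends r (e i) `&` edge_ends r (e j) &
        forall i c a b, e i = Arc c a b -> K (Circle c)].
Proof.
move=> r0 cX perfect fK wfK XK m0 Xm fW thin.
have [K' [fK' K'K KK' injK']] := distinct_curves fK.
have wk k : K' k -> curve_wf k by move=> /K'K /wfK.
pose cross k := \bigcup_(l in K') [set z | k <> l /\ curve_set r k z /\ curve_set r l z].
pose ends k := [set curve_at r k (param_lo m k); curve_at r k (param_mid m k);
                 curve_at r k (param_hi m k)].
(* With all crossings among the vertices, a point outside [V] lies on at most one curve of [K']. *)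
pose V := W `|` \bigcup_(k in K') (cross k `|` ends k).
have fV : finite_set V.
  rewrite finite_setU; split=> //; apply: bigcup_finite => // k K'k.
  rewrite finite_setU; split; last first.
    by rewrite finite_setU; split; [exact: finite_set2|exact: finite_set1].
  apply: bigcup_finite => // l K'l.
  have [->|kl] := pselect (k = l); first by apply: (@sub_finite_set _ _ set0) => // z [].
  apply: (@sub_finite_set _ _ (curve_set r k `&` curve_set r l)); first by move=> z [_ ?].
  by apply: finite_curveI; [exact: wk|exact: wk|move=> kl'; apply: kl; exact: injK'].
have VW x : ~ V x -> ~ W x by move=> nV Wx; apply: nV; left.
have Vends k : K' k -> ends k `<=` V by move=> K'k z ez; right; exists k => //; right.
have Vlo k : K' k -> V (curve_at r k (param_lo m k)).
  by move=> /Vends; apply; left; left.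
have Vmid k : K' k -> V (curve_at r k (param_mid m k)).
  by move=> /Vends; apply; left; right.
have Vhi k : K' k -> V (curve_at r k (param_hi m k)).
  by move=> /Vends; apply; right.
have Vcross k l x : K' k -> K' l -> curve_set r k x -> curve_set r l x -> ~ V x -> k = l.
  move=> K'k K'l kx lx nV; apply: contrapT => kl; apply: nV; right; exists k => //.
  by left; exists l.
have inj k t u : K' k -> param_lo m k <= t <= param_hi m k ->
    param_lo m k <= u <= param_hi m k -> ~ V (curve_at r k t) ->
    curve_at r k t = curve_at r k u -> t = u.
  move=> K'k /andP[t1 t2] u12 nV; apply: (param_inj r0 (wk _ K'k) _ u12).
  rewrite !lt_neqAle t1 t2 !andbT; apply/andP; split; apply/eqP => tE; apply: nV.
    by rewrite -tE; exact: Vlo.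
  by rewrite tE; exact: Vhi.
pose T k := [set t | param_lo m k <= t <= param_hi m k /\ V (curve_at r k t)].
have fT k : K' k -> finite_set (T k).
  move=> K'k.
  (* Besides the two ends of the interval, each vertex has at most one parameter on [k]. *)
  apply: (@sub_finite_set _ _ ([set param_lo m k; param_hi m k] `|`
    \bigcup_(v in V) [set t | param_lo m k < t < param_hi m k /\ curve_at r k t = v])).
    move=> t [/andP[]]; rewrite le_eqVlt => /orP[/eqP <- _ _|t1]; first by left; left.
    rewrite le_eqVlt => /orP[/eqP -> _|t2 Vt]; first by left; right.
    by right; exists (curve_at r k t) => //; split=> //; rewrite t1.
  rewrite finite_setU; split; first exact: finite_set2.
  apply: bigcup_finite => // v _.
  have [[t [t12 tv]]|no] := pselect (exists t, param_lo m k < t < param_hi m k /\ curve_at r k t = v).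
    apply: (@sub_finite_set _ _ [set t]); last exact: finite_set1.
    move=> u [/andP[u1 u2] uv]; apply/esym/(param_inj r0 (wk _ K'k) t12); last by rewrite tv uv.
    by rewrite !ltW.
  by apply: (@sub_finite_set _ _ set0) => // t tP; apply: no; exists t.
have local k x : K' k -> curve_set r k x -> boundary X x -> ~ V x ->
    exists2 M, nbhs x M & M `&` curve_set r k `<=` boundary X.
  move=> K'k kx bx nV.
  (* Off the closed union of the other curves, the boundary can only lie on [k]. *)
  pose U := \bigcup_(l in K' `\` [set k]) curve_set r l.
  have cU : closed U.
    apply: closed_bigcup_finite => [|l _]; last exact: closed_curve.
    by apply: (sub_finite_set _ fK') => l [].
  have nU : ~ U x.
    by move=> [l [K'l lk] lx]; apply: lk; apply: (Vcross l k x).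
  apply: (@boundary_along_curve X (~` U) k x r0 cX (wk _ K'k) kx bx).
  - by apply: open_nbhs_nbhs; split=> //; exact: closed_openC.
  - move=> z nUz bz; have [l Kl lz] := XK _ bz; have [l' K'l' ll'] := KK' _ Kl.
    apply: contrapT => nkz; apply: nUz; exists l'; last by rewrite ll'.
    by split=> // l'k; apply: nkz; rewrite -l'k ll'.
  - have [ci|[l [Kl lx] [N Nx NX]]] := thin _ bx (VW _ nV); [by left|right].
    have [l' K'l' ll'] := KK' _ Kl; exists N => //.
    by rewrite (Vcross k l' x K'k K'l' kx _ nV) ?ll'.
have inV k a b t : K' k -> consecutive V m k a b -> a <= t <= b ->
    V (curve_at r k t) -> t = a \/ t = b.
  move=> K'k [_ _ _ _ nV] /andP[]; rewrite le_eqVlt => /orP[/eqP ->|t1]; first by left.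
  rewrite le_eqVlt => /orP[/eqP ->|t2]; first by right.
  by move=> /(nV t)[]; rewrite t1.
have whole k a b t : K' k -> consecutive V m k a b -> a < t < b ->
    boundary X (curve_at r k t) -> curve_at r k @` `[a, b] `<=` boundary X.
  move=> K'k [[loa bhi] ab _ _ nV] t12 bt.
  pose B := curve_at r k @^-1` boundary X.
  have cB : closed B.
    by apply: closed_comp; [move=> ? _; exact: curve_at_continuous|exact: closed_boundary].
  (* The boundary is closed, and it is open along the edge by [local]; connectedness of the interval
     gives all of it once it contains [t]. *)
  have BE : `]a, b[%classic `&` B = `]a, b[%classic.
    have /connected_intervalP : is_interval `]a, b[%classic by exact: interval_is_interval.
    apply.
    - by exists t; split=> //; rewrite /= in_itv.
    - exists B^°; first exact: open_interior.
      apply/seteqP; split=> u [uab Bu]; split=> //; last exact: interior_subset.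
      have uab' : a < u < b by move: uab; rewrite /= in_itv.
      have [M Mu MB] := local k _ K'k (curve_at_in r k u) Bu (nV _ uab').
      have : nbhs u (curve_at r k @^-1` M) by exact: curve_at_continuous.
      by apply: filterS => w Mw; apply: MB; split=> //; exact: curve_at_in.
    - by exists B.
  have sB : `]a, b[%classic `<=` B by rewrite -BE => ? [].
  move=> _ [u /= uab <-]; rewrite -/(B u); apply: cB => N /nbhs_ballP[e e0 Ne].
  (* The ends of the edge are limits of inner parameters: [u] is moved by [s / 2] toward the farther
     end. *)
  have [w [w1 w2]] : exists w, a < w < b /\ `|u - w| < e.
    move: uab; rewrite in_itv /= => /andP[u1 u2].
    pose s := Num.min (e / 2) ((b - a) / 2).
    have s0 : 0 < s by rewrite lt_min !divr_gt0 // subr_gt0.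
    have se : s <= e / 2 by rewrite ge_min lexx.
    have sb : s <= (b - a) / 2 by rewrite ge_min lexx orbT.
    have e0' : 0 < e by [].
    have [ub|ub] := ltP u ((a + b) / 2).
      exists (u + s / 2); split; first lra.
      by rewrite opprD addrA subrr add0r normrN gtr0_norm; lra.
    exists (u - s / 2); split; first lra.
    by rewrite opprB addrC subrK gtr0_norm; lra.
  exists w; split; first by apply: sB; rewrite /= in_itv.
  by apply: Ne; rewrite -ball_normE.
pose J := [set j : curve R * (R * R) | [/\ K' j.1, consecutive V m j.1 j.2.1 j.2.2 &
  curve_at r j.1 @` `[j.2.1, j.2.2] `<=` boundary X]].
have fJ : finite_set J.
  apply: (@sub_finite_set _ _ (\bigcup_(k in K') ([set k] `*` (T k `*` T k)))).
    move=> [k [a b]] [/= K'k [[loa bhi] ab Va Vb _] _]; exists k => //; split=> //.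
    by split; split=> //=; apply/andP; split=> //; [exact: ltW (lt_le_trans ab bhi)|exact: ltW (le_lt_trans loa ab)].
  apply: bigcup_finite => // k K'k; apply: finite_setX; first exact: finite_set1.
  by apply: finite_setX; exact: fT.
pose ed (j : curve R * (R * R)) := curve_edge r j.1 j.2.1 j.2.2.
have edE j : J j -> edge_set r (ed j) = curve_at r j.1 @` `[j.2.1, j.2.2].
  by move=> [_ [_ ab _ _ _] _]; exact: curve_edge_set.
pose G := \bigcup_(j in J) edge_set r (ed j).
have cG : closed G.
  by apply: closed_bigcup_finite => // j Jj; rewrite edE //; exact: closed_curve_part.
have bG : boundary X = G.
  apply/seteqP; split; last by move=> x [j Jj]; rewrite edE // => jx; case: Jj => _ _; apply.
  have nVG x : boundary X x -> ~ V x -> G x.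
    move=> bx nV; have [l Kl lx] := XK _ bx; have [k K'k kl] := KK' _ Kl.
    have [x1 x2] := Xm _ bx; rewrite -kl in lx.
    have [t /andP[t1 t2] tE] := param_surj r0 m0 (wk _ K'k) lx x1 x2.
    (* The edge through [x] is delimited by the nearest vertex parameters on either side of [t]. *)
    have [a [[[/andP[a1 a2] Va] at_] amax]] : exists a, (T k `&` [set u | u <= t]) a /\
        forall b, (T k `&` [set u | u <= t]) b -> b <= a.
      apply: finite_max; first by apply: (sub_finite_set _ (fT _ K'k)) => ? [].
      exists (param_lo m k); split=> //; split; last exact: Vlo.
      by rewrite lexx (le_trans t1).
    have [b [[[/andP[b1 b2] Vb] tb] bmin]] : exists a, (T k `&` [set u | t <= u]) a /\
        forall b, (T k `&` [set u | t <= u]) b -> a <= b.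
      apply: finite_min; first by apply: (sub_finite_set _ (fT _ K'k)) => ? [].
      exists (param_hi m k); split=> //; split; last exact: Vhi.
      by rewrite lexx (le_trans t1).
    have {}at_ : a < t.
      rewrite lt_neqAle at_ andbT; apply/eqP => aE; apply: nV; rewrite tE -aE; exact: Va.
    have {}tb : t < b.
      rewrite lt_neqAle tb andbT; apply/eqP => bE; apply: nV; rewrite tE bE; exact: Vb.
    have cons : consecutive V m k a b.
      split=> //; first exact: lt_trans tb.
      move=> u /andP[au ub] Vu.
      have uT : T k u by split=> //; apply/andP; split; [exact: le_trans a1 (ltW au)|exact: le_trans (ltW ub) b2].
      have [ut|tu] := leP u t.
        by have := amax u (conj uT ut); rewrite leNgt au.
      by have := bmin u (conj uT (ltW tu)); rewrite leNgt ub.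
    have Jj : J (k, (a, b)).
      by split=> //; apply: (whole k a b t) => //; rewrite -?tE // at_ tb.
    exists (k, (a, b)) => //; rewrite edE //; exists t => //=.
    by rewrite in_itv /= !ltW.
  move=> x bx; apply: contrapT => nG.
  (* Near a boundary point [x] outside the closed set [G] there would be another boundary point,
     neither in [G] nor a vertex, against [nVG]. *)
  have [|y [[nGy nVy] by_ yx]] := boundary_not_isolated cX
     (fun N Nx => perfect x N (boundary_closed cX bx) Nx) bx (N := ~` G `&` ~` (V `\ x)).
    apply: filterI; apply: open_nbhs_nbhs; split=> //; try exact: closed_openC.
      apply: closed_openC; apply: (closed_finite (@plane_hausdorff R)).
      by apply: (sub_finite_set _ fV) => ? [].
    by move=> [_ /=].
  by apply: nGy; apply: nVG => // Vy; apply: nVy; split.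
have [n [f [finj fE]]] := finite_enum fJ.
have Jf i : J (f i) by rewrite fE; exists i.
exists n, (fun i => ed (f i)); split.
- move=> i; case: (Jf i) => K'k [[loa bhi] ab Va Vb nV] _; rewrite /ed.
  have := wk _ K'k; have := Vmid _ K'k; move: (f i) K'k loa bhi ab Va Vb nV.
  move=> [[p d|c] [a b]] /= K'k loa bhi ab Va Vb nV Vm wf.
    by move=> /(@line_at_inj _ r p d a b wf) abE; rewrite abE ltxx in ab.
  (* An interval as long as a full turn would contain the vertex parameter [pi] strictly inside. *)
  rewrite ab /=; rewrite ltNge; apply/negP => le.
  have pi0 := pi_gt0 R.
  by apply: (nV pi) => //; lra.
- rewrite bG /G fE; apply/seteqP; split=> [x [_ [i _ <-] ix]|x [i _ ix]]; first by exists i.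
  by exists (f i) => //; exists i.
- move=> i j ij x []; rewrite !edE //.
  have := Jf i; have := Jf j.
  have : f i <> f j by move=> /finj.
  rewrite /ed; move: (f i) (f j) => [k [a b]] [l [a' b']] /= fij [/= K'l consl _] [/= K'k consk _].
  move=> [t /=]; rewrite in_itv /= => tab tx [u]; rewrite in_itv /= => uab ux.
  have [Vx|nV] := pselect (V x).
    rewrite !curve_edge_ends; split.
      have Vt : V (curve_at r k t) by rewrite tx.
      by have [tE|tE] := inV k a b t K'k consk tab Vt; rewrite -tx tE; [left|right].
    have Vu : V (curve_at r l u) by rewrite ux.
    by have [uE|uE] := inV l a' b' u K'l consl uab Vu; rewrite -ux uE; [left|right].
  (* A common point that is no vertex lies on a single curve, at a single parameter, hence in a
     single interval between consecutive vertices. *)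
  have kl : k = l.
    by apply: (Vcross k l x) => //; [rewrite -tx|rewrite -ux]; exact: curve_at_in.
  case: fij; move: consl K'l uab ux; rewrite -kl => {l kl} consl K'l uab ux.
  case: (consk) => [[loa bhi] ab Va Vb nVab]; case: (consl) => [[loa' bhi'] ab' Va' Vb' nVab'].
  have tu : t = u.
    apply: (inj k t u) => //; rewrite ?tx ?ux //.
      by case/andP: tab => h1 h2; rewrite (le_trans loa h1) (le_trans h2 bhi).
    by case/andP: uab => h1 h2; rewrite (le_trans loa' h1) (le_trans h2 bhi').
  rewrite -tu in uab ux.
  have tne s : V (curve_at r k s) -> t != s by move=> Vs; apply/eqP => ts; apply: nV; rewrite -tx ts.
  have t_a := tne _ Va; have t_b := tne _ Vb; have t_a' := tne _ Va'; have t_b' := tne _ Vb'.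
  have {}tab : a < t < b by rewrite !lt_neqAle eq_sym t_a t_b.
  have {}uab : a' < t < b' by rewrite !lt_neqAle eq_sym t_a' t_b'.
  case/andP: tab uab => t1 t2 /andP[t3 t4].
  have aE : a = a'.
    apply/eqP; rewrite eq_le !leNgt; apply/andP; split; apply/negP => lt.
      by apply: (nVab' a) => //; rewrite lt (lt_trans t1 t4).
    by apply: (nVab a') => //; rewrite lt (lt_trans t3 t2).
  have bE : b = b'.
    apply/eqP; rewrite eq_le !leNgt; apply/andP; split; apply/negP => lt.
      by apply: (nVab b') => //; rewrite lt (lt_trans t1 t4).
    by apply: (nVab' b) => //; rewrite lt (lt_trans t3 t2).
  by rewrite aE bE.
- move=> i c a b; case: (Jf i) => /K'K Kk _ _; rewrite /ed; case: (f i) Kk => [[p d|c'] [a' b']] //= Kk.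
  by move=> [<- _ _].
Qed.

End ArrangementTheorem.

(** * Distances *)

(** Squaring keeps comparisons of Euclidean distances polynomial. *)
Definition distsq (R : realType) (x y : plane R) : R :=
  (x.1 - y.1) ^+ 2 + (x.2 - y.2) ^+ 2.

Section DentGeometry.
Context {R : realType}.
Implicit Types (x y z p q c v : plane R) (X N M : set (plane R)).

Lemma edge_set_closed (r : R) (e : edge R) : closed (edge_set r e).
Proof.
case: e => [p q|c a b]; first exact: closed_segment.
exact: (@closed_curve_part _ r (Circle c)).
Qed.

Lemma edge_set_compact (r : R) (e : edge R) : compact (edge_set r e).
Proof.
case: e => [p q|c a b]; first exact: compact_segment.
exact: (@compact_curve_part _ r (Circle c)).
Qed.

Lemma arc_sub_circle (r : R) c a b : Defs.arc c r a b `<=` curve_set r (Circle c).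
Proof. by move=> _ [t _ <-]; exact: (@curve_at_in _ r (Circle c)). Qed.

(** Tangential moves of [y] stay outside the circle, so [z - y] has no tangential component; the
    outward move makes its normal component nonpositive. If that component were longer than [r],
    following the circle would bring [y] closer to [z]. *)
Lemma nearest_outside (r : R) c y z X : 0 < r ->
  curve_set r (Circle c) y ->
  (exists2 M, nbhs y M & forall x, M x -> 0 < curve_eq r (Circle c) x -> X x) ->
  (forall x, X x -> distsq z y <= distsq z x) -> distsq z y <= r ^+ 2.
Proof.
move=> r0 /(circle_normal r0)[n [n1 yE n11 n21]] [M /nbhs_plane[e e0 Me] MX] near.
pose A := z.1 - y.1; pose B := z.2 - y.2.
(* [al] and [be] are the normal and the tangential coordinate of [z - y]. *)
pose al := A * n.1 + B * n.2; pose be := B * n.1 - A * n.2.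
have dE : distsq z y = al ^+ 2 + be ^+ 2.
  rewrite /al /be (_ : _ + _ = (A ^+ 2 + B ^+ 2) * (n.1 ^+ 2 + n.2 ^+ 2)); last by ring.
  by rewrite n1 mulr1.
(* Compares [y] with the point at tangential offset [s] and normal offset [t]. The second premise
   says that this point is outside the circle; the conclusion is minimality, expanded. *)
have key s t : `|s| + `|t| < e -> 0 < s ^+ 2 + t ^+ 2 + r * t *+ 2 ->
    (s * be + t * al) *+ 2 <= s ^+ 2 + t ^+ 2.
  move=> st F; pose x : plane R := (y.1 - s * n.2 + t * n.1, y.2 + s * n.1 + t * n.2).
  have small (a b : R) : `|a| <= 1 -> `|b| <= 1 -> `|s * a + t * b| < e.
    move=> a1 b1; apply: le_lt_trans st; apply: (le_trans (ler_normD _ _)).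
    by rewrite !normrM lerD // ler_piMr.
  have Mx : M x.
    apply: Me => /=.
      have -> : y.1 - s * n.2 + t * n.1 - y.1 = s * - n.2 + t * n.1 by ring.
      by apply: small; rewrite ?normrN.
    have -> : y.2 + s * n.1 + t * n.2 - y.2 = s * n.1 + t * n.2 by ring.
    exact: small.
  have Fx : curve_eq r (Circle c) x = s ^+ 2 + t ^+ 2 + r * t *+ 2.
    rewrite /= yE /=.
    have -> : (c.1 + r * n.1 - s * n.2 + t * n.1 - c.1) ^+ 2 +
      (c.2 + r * n.2 + s * n.1 + t * n.2 - c.2) ^+ 2 - r ^+ 2 =
      ((r + t) ^+ 2 + s ^+ 2) * (n.1 ^+ 2 + n.2 ^+ 2) - r ^+ 2 by ring.
    by rewrite n1; ring.
  have Xx : X x by apply: MX => //; rewrite Fx.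
  have := near x Xx.
  have -> : distsq z x = A ^+ 2 + B ^+ 2 - (s * be + t * al) *+ 2
      + (s ^+ 2 + t ^+ 2) * (n.1 ^+ 2 + n.2 ^+ 2).
    by rewrite /distsq /x /al /be /A /B /=; ring.
  have -> : distsq z y = A ^+ 2 + B ^+ 2 by [].
  by rewrite n1 mulr1; lra.
have be0 : be = 0.
  apply/eqP; rewrite eq_le !leNgt; apply/andP; split; apply/negP => lt.
    pose s := Num.min (e / 2) be.
    have s0 : 0 < s by rewrite lt_min divr_gt0.
    have se : s <= e / 2 by rewrite ge_min lexx.
    have sb : s <= be by rewrite ge_min lexx orbT.
    have se' : `|s| + `|0 : R| < e by rewrite normr0 gtr0_norm //; lra.
    by have := key s 0 se' ltac:(nra); nra.
  pose s := Num.min (e / 2) (- be).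
  have s0 : 0 < s by rewrite lt_min divr_gt0 //= oppr_gt0.
  have se : s <= e / 2 by rewrite ge_min lexx.
  have sb : s <= - be by rewrite ge_min lexx orbT.
  have se' : `|- s| + `|0 : R| < e by rewrite normr0 normrN gtr0_norm //; lra.
  by have := key (- s) 0 se' ltac:(nra); nra.
have al0 : al <= 0.
  rewrite leNgt; apply/negP => lt; pose s := Num.min (e / 2) al.
  have s0 : 0 < s by rewrite lt_min divr_gt0.
  have se : s <= e / 2 by rewrite ge_min lexx.
  have sb : s <= al by rewrite ge_min lexx orbT.
  have se' : `|0 : R| + `|s| < e by rewrite normr0 gtr0_norm //; lra.
  by have := key 0 s se' ltac:(nra); nra.
rewrite dE be0 expr0n /= addr0 leNgt; apply/negP => lt.
have kr : r < - al by nra.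
pose u := Num.min (e / 4) (Num.min r (- al - r)).
have u0 : 0 < u by rewrite !lt_min r0 divr_gt0 //= subr_gt0.
have ue : u <= e / 4 by rewrite ge_min lexx.
have ur : u <= r by rewrite !ge_min lexx orbT.
have uk : u <= - al - r by rewrite !ge_min lexx !orbT.
(* The offsets [u] and [- g] follow the circle to second order: the equation of the circle takes the
   value [g ^+ 2] there, which is just outside. Minimality then gives [2 * (- al - r) <= g], against
   [g <= u <= - al - r]. *)
pose g := u ^+ 2 / (r *+ 2).
have gE : r * g *+ 2 = u ^+ 2 by rewrite -mulrnAl /g mulrC divfK // mulrn_eq0 /= gt_eqF.
have g0 : 0 < g by rewrite divr_gt0 ?exprn_gt0 // pmulrn_lgt0.
have gu : g <= u.
  rewrite -(ler_pM2l r0); move: gE; rewrite mulr2n expr2; nra.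
have ug : `|u| + `|- g| < e by rewrite normrN !gtr0_norm //; lra.
have Fg : 0 < u ^+ 2 + (- g) ^+ 2 + r * (- g) *+ 2.
  by rewrite mulrN mulNrn gE sqrrN addrAC subrr add0r exprn_gt0.
have := key u (- g) ug Fg; rewrite be0 mulr0 add0r sqrrN -gE.
have : g * g <= g * (- al - r) by apply: ler_wpM2l; lra.
have : 0 < g * (- al - r) by apply: mulr_gt0; lra.
by rewrite !mulr2n !expr2 !mulNr; lra.
Qed.

Lemma edge_end_in (r : R) (f : edge R) : edge_nondegenerate f ->
  edge_ends r f `<=` edge_set r f.
Proof.
case: f => [p q|c a b] /= nd x.
  by move=> [->|->]; [exact: segment_left|exact: segment_right].
by case/andP: nd => /ltW ab _ [->|->]; [exists a|exists b] => //=; rewrite in_itv /= lexx ab.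
Qed.

End DentGeometry.

(** * Frames at a point of a circle *)

Section TangentFrame.
Context {R : realType}.
Implicit Types (x y z p q c v : plane R) (X N M : set (plane R)).

Lemma finite_common_bound n (Q : 'I_n -> R -> Prop) :
  (forall i, exists2 h : R, 0 < h & forall t, 0 < t < h -> Q i t) ->
  exists2 h : R, 0 < h & forall t i, 0 < t < h -> Q i t.
Proof.
move=> H; have [f fP] := choice (fun i => let: ex_intro2 h h0 Hh := H i in
  ex_intro (fun h => 0 < h /\ forall t, 0 < t < h -> Q i t) h (conj h0 Hh)).
have [||m [mA mmin]] := @finite_min _ ([set 1] `|` range f).
- by rewrite finite_setU; split; [exact: finite_set1|apply: finite_image; exact: finite_finset].
- by exists 1; left.
exists m.
  by case: mA => [->|[i _ <-]] //; have [] := fP i.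
move=> t i /andP[t0 tm]; have [_] := fP i; apply; rewrite t0 (lt_le_trans tm) //.
by apply: mmin; right; exists i.
Qed.

(* The point with coordinates [s], [t] in the frame of origin [v] with unit
   normal [n] and tangent [(- n.2, n.1)]. *)
Definition frame v n (s t : R) : plane R :=
  (v.1 - s * n.2 + t * n.1, v.2 + s * n.1 + t * n.2).

Lemma frame_segment v n s t s' t' z : segment (frame v n s t) (frame v n s' t') z ->
  exists2 w, 0 <= w <= 1 &
    z = frame v n ((1 - w) * s + w * s') ((1 - w) * t + w * t').
Proof.
move=> /segmentP[w w01 ->]; exists w => //; congr pair; rewrite /=; ring.
Qed.

Lemma frame_near v n (e s t : R) : n.1 ^+ 2 + n.2 ^+ 2 = 1 -> `|s| + `|t| < e ->
  `|(frame v n s t).1 - v.1| < e /\ `|(frame v n s t).2 - v.2| < e.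
Proof.
move=> n1 st.
have n11 := norm_le1_of_sqr n1; have n21 : `|n.2| <= 1 by apply: (@norm_le1_of_sqr _ _ n.1); rewrite addrC.
have small (a b : R) : `|a| <= 1 -> `|b| <= 1 -> `|s * a + t * b| < e.
  move=> a1 b1; apply: le_lt_trans st; apply: (le_trans (ler_normD _ _)).
  by rewrite !normrM lerD // ler_piMr.
split; rewrite /frame /=.
  have -> : v.1 - s * n.2 + t * n.1 - v.1 = s * - n.2 + t * n.1 by ring.
  by apply: small; rewrite ?normrN.
have -> : v.2 + s * n.1 + t * n.2 - v.2 = s * n.1 + t * n.2 by ring.
exact: small.
Qed.

(* The region between a circle of radius [r], with outer normal [n] at [v], and
   its tangent at [v] is locally disjoint from any other circle of radius [r]
   through [v]: that circle either crosses the tangent or is symmetric to the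
   first one. *)
Lemma tangent_gap_circle (r : R) c v n : 0 < r -> n.1 ^+ 2 + n.2 ^+ 2 = 1 ->
  curve_set r (Circle c) v ->
  exists2 h : R, 0 < h & forall s t, 0 < `|s| < h -> - (s ^+ 2) <= r * t -> t <= 0 ->
    0 < s ^+ 2 + t ^+ 2 + r * t *+ 2 -> ~ curve_set r (Circle c) (frame v n s t).
Proof.
rewrite /curve_set /= => r0 n1 cv.
(* [mp] and [mq] are the tangential and the normal coordinate of [c - v]. *)
pose mp := (c.2 - v.2) * n.1 - (c.1 - v.1) * n.2.
pose mq := (c.1 - v.1) * n.1 + (c.2 - v.2) * n.2.
have mE : mp ^+ 2 + mq ^+ 2 = r ^+ 2.
  rewrite (_ : _ + _ = ((v.1 - c.1) ^+ 2 + (v.2 - c.2) ^+ 2) * (n.1 ^+ 2 + n.2 ^+ 2)); last first.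
    by rewrite /mp /mq; ring.
  by rewrite n1 mulr1; lra.
have circ s t : curve_eq r (Circle c) (frame v n s t) =
    s ^+ 2 + t ^+ 2 - (s * mp + t * mq) *+ 2.
  rewrite /= /frame /=.
  have -> : (v.1 - s * n.2 + t * n.1 - c.1) ^+ 2 + (v.2 + s * n.1 + t * n.2 - c.2) ^+ 2 - r ^+ 2 =
    ((v.1 - c.1) ^+ 2 + (v.2 - c.2) ^+ 2 - r ^+ 2) + (s ^+ 2 + t ^+ 2) * (n.1 ^+ 2 + n.2 ^+ 2)
     - (s * mp + t * mq) *+ 2 by rewrite /mp /mq; ring.
  by rewrite cv add0r n1 mulr1.
(* If [mp = 0], the center is on the normal and [mq] is [r] or [- r]: the circle is either on the
   other side of the tangent, or the one excluded by the strict premise [F]. *)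
have [mp0|mp0] := eqVneq mp 0.
  exists 1 => // s t /andP[s0 _] _ t0 F; have := circ s t; rewrite /= => ->.
  have {}s0 : 0 < s ^+ 2 by rewrite lt_neqAle sqr_ge0 andbT eq_sym sqrf_eq0 -normr_gt0.
  rewrite mp0 mulr0 add0r => E.
  have : (mq - r) * (mq + r) = 0 by rewrite -subr_sqr -mE mp0; ring.
  move/eqP; rewrite mulf_eq0 subr_eq0 addr_eq0 => /orP[/eqP mqE|/eqP mqE].
    by rewrite mqE in E; have := sqr_ge0 t; nra.
  by rewrite mqE in E; nra.
(* A point of the circle in the gap would satisfy [2 * |s| * |mp| <= 4 * |s| ^ 2], which fails for
   [|s| < |mp| / 2]. The bound [|s| < r] serves to get [- t <= |s|]. *)
pose h := Num.min r (`|mp| / 2).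
have h0 : 0 < h by rewrite lt_min r0 divr_gt0 // normr_gt0.
exists h => // s t /andP[s0]; rewrite lt_min => /andP[sr sm] st t0 F.
have := circ s t; rewrite /= => -> E.
have s2 : s ^+ 2 = `|s| ^+ 2 by rewrite real_normK // num_real.
have sn : `|s * mp| = `|s| * `|mp| by exact: normrM.
move: (`|s|) s0 sr sm s2 sn => a a0 ar am s2 sn.
have mq1 : `|mq| <= r by rewrite ler_norml; apply/andP; split; nra.
have ta : - t <= a by rewrite -(ler_pM2l r0); nra.
have rt : r * - t <= a ^+ 2 by lra.
have : `|s * mp| *+ 2 <= a ^+ 2 *+ 4.
  have -> : s * mp = (s ^+ 2 + t ^+ 2) / 2 - t * mq by lra.
  have tm : `|t * mq| <= a ^+ 2.
    by rewrite normrM ler0_norm // (le_trans _ rt) // mulrC ler_wpM2r ?oppr_ge0.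
  have := ler_normB ((s ^+ 2 + t ^+ 2) / 2) (t * mq).
  rewrite (@ger0_norm _ ((s ^+ 2 + t ^+ 2) / 2)) ?divr_ge0 ?addr_ge0 ?sqr_ge0 //.
  have : t ^+ 2 <= a ^+ 2 by nra.
  by rewrite s2; move: (a ^+ 2) (t ^+ 2) (`|_ - _|) tm => ? ? ? ?; lra.
rewrite sn.
have mp1 : 0 < `|mp| by rewrite normr_gt0.
move: (`|mp|) mp1 am => m m0 am; nra.
Qed.

(** [sg] is the tangential direction in which the arc leaves its end [v]: positive at the starting
    angle, negative at the final one. *)
Lemma arc_end_frame (r : R) c (a b : R) v : a < b -> [set circle_point c r a; circle_point c r b] v ->
  exists m (sg : R), [/\ m.1 ^+ 2 + m.2 ^+ 2 = 1, v = (c.1 + r * m.1, c.2 + r * m.2),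
    sg = 1 \/ sg = -1 & forall h, 0 < h < b - a -> exists2 t, a < t < b &
      circle_point c r t = frame v m (sg * (r * sin h)) (r * cos h - r)].
Proof.
move=> ab [->|->].
  exists (cos a, sin a), 1; split=> //=; [exact: cos2Dsin2|by left|] => h h12.
  exists (a + h); first by lra.
  by rewrite /circle_point cosD sinD /frame /=; congr pair; ring.
exists (cos b, sin b), (-1); split=> //=; [exact: cos2Dsin2|by right|] => h h12.
exists (b - h); first by lra.
by rewrite /circle_point cosB sinB /frame /=; congr pair; ring.
Qed.

Lemma small_angle (r h0 h1 : R) : 0 < r -> 0 < h0 -> 0 < h1 ->
  exists h : R, [/\ 0 < h < h0, 0 < r * sin h < h1 & 0 <= cos h].
Proof.
move=> r0 h00 h10.
have : nbhs (0 : R) ((fun h : R => r * sin h) @^-1` [set z | `|z| < h1]).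
  have c : continuous (fun h : R => r * sin h).
    by move=> h; apply: cvgM; [exact: cvg_cst|exact: continuous_sin].
  apply: c; rewrite sin0 mulr0; apply/nbhs_ballP; exists h1 => // z.
  by rewrite -ball_normE /= sub0r normrN.
move=> /nbhs_ballP[d /= d0 Hd].
pose h := Num.min (d / 2) (Num.min (h0 / 2) (1 / 2)).
have hp : 0 < h by rewrite !lt_min !divr_gt0 /=.
have hd : h <= d / 2 by rewrite ge_min lexx.
have hh : h <= h0 / 2 by rewrite !ge_min lexx orbT.
have h1' : h <= 1 / 2 by rewrite !ge_min lexx !orbT.
exists h; split.
- by lra.
- have s0 : 0 < sin h by apply: sin2_gt0; lra.
  rewrite mulr_gt0 //=.
  have : `|r * sin h| < h1 by apply: Hd; rewrite -ball_normE /= sub0r normrN gtr0_norm //; lra.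
  by apply: le_lt_trans; exact: ler_norm.
- by apply/ltW/cos_gt0_pihalf; have := pi_ge2 R; lra.
Qed.

End TangentFrame.

Lemma compact_bigcup_finite (T : topologicalType) (I : Type) (A : set I)
    (F : I -> set T) :
  finite_set A -> (forall i, A i -> compact (F i)) -> compact (\bigcup_(i in A) F i).
Proof.
move=> /finite_enum[n [f [_ ->]]] cF.
have -> : \bigcup_(i in range f) F i = \bigcup_(i in [set: 'I_n]) F (f i).
  apply/seteqP; split=> [x [_ [i _ <-] Fx]|x [i _ Fx]]; first by exists i.
  by exists (f i) => //; exists i.
rewrite -bigsetU_fset_set; last exact: finite_finset.
by apply: bigsetU_compact => i _; apply: cF; exists i.
Qed.

Lemma finite_choice (T U : Type) (A : set T) (Q : T -> U -> Prop) :
  finite_set A -> (forall x, A x -> exists u, Q x u) ->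
  exists B, [/\ finite_set B, forall u, B u -> exists2 x, A x & Q x u &
                 forall x, A x -> exists2 u, B u & Q x u].
Proof.
move=> /finite_enum[n [f [_ ->]]] H.
have [g gP] := choice (fun i => H (f i) (ex_intro2 _ _ i I erefl)).
exists (range g); split.
- by apply: finite_image; exact: finite_finset.
- by move=> _ [i _ <-]; exists (f i) => //; exists i.
- by move=> _ [i _ <-]; exists (g i) => //; exists i.
Qed.

(** * Squared distances, nearest points and offsets *)

Section Distance.
Context {R : realType}.
Implicit Types (x y z p q c v : plane R) (X N M : set (plane R)).

Lemma compact_plane_bounded X : compact X ->
  exists2 m : R, 0 <= m & forall x, X x -> `|x.1| <= m /\ `|x.2| <= m.
Proof.
move=> /compact_bounded /ex_strict_bound_gt0[m m0 mX]; exists m; first exact: ltW.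
move=> x /mX /= /ltW; rewrite prod_normE ge_max => /andP[]; by [].
Qed.

Lemma distsq_ge0 x y : 0 <= distsq x y.
Proof. by rewrite addr_ge0 ?sqr_ge0. Qed.

Lemma distsqC x y : distsq x y = distsq y x.
Proof. by rewrite /distsq; ring. Qed.

Lemma distsq_gt0 x y : x <> y -> 0 < distsq x y.
Proof.
move=> xy; rewrite lt_neqAle distsq_ge0 andbT eq_sym paddr_eq0 ?sqr_ge0 // !sqrf_eq0 !subr_eq0.
by apply/negP => /andP[/eqP E1 /eqP E2]; apply: xy; rewrite [x]surjective_pairing [y]surjective_pairing E1 E2.
Qed.

Lemma distsq_near x y (e : R) : `|x.1 - y.1| <= e -> `|x.2 - y.2| <= e ->
  distsq x y <= (e *+ 2) ^+ 2.
Proof.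
rewrite !ler_norml /distsq => /andP[? ?] /andP[? ?]; rewrite mulr2n; nra.
Qed.

(** Cauchy-Schwarz bounds the scalar product of the two differences by [a * b]. *)
Lemma distsq_triangle x y z (a b : R) : 0 <= a -> 0 <= b ->
  distsq x y <= a ^+ 2 -> distsq y z <= b ^+ 2 -> distsq x z <= (a + b) ^+ 2.
Proof.
move=> a0 b0; rewrite /distsq.
have -> : x.1 - z.1 = (x.1 - y.1) + (y.1 - z.1) by ring.
have -> : x.2 - z.2 = (x.2 - y.2) + (y.2 - z.2) by ring.
move: (x.1 - y.1) (x.2 - y.2) (y.1 - z.1) (y.2 - z.2) => u1 u2 v1 v2 U V.
have W : (u1 * v1 + u2 * v2) ^+ 2 <= (a * b) ^+ 2.
  apply: (@le_trans _ _ ((u1 ^+ 2 + u2 ^+ 2) * (v1 ^+ 2 + v2 ^+ 2))).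
    rewrite -subr_ge0 (_ : _ - _ = (u1 * v2 - u2 * v1) ^+ 2) ?sqr_ge0 //; ring.
  by rewrite exprMn ler_pM // addr_ge0 ?sqr_ge0.
have : u1 * v1 + u2 * v2 <= a * b.
  apply: (le_trans (ler_norm _)); rewrite -(ler_pXn2r (ltn0Sn 1)) ?nnegrE ?mulr_ge0 //.
  by rewrite real_normK ?num_real.
lra.
Qed.

Lemma distsq_convex c p q (t : R) (rho : R) : 0 <= t <= 1 ->
  distsq p c <= rho -> distsq q c <= rho ->
  distsq ((1 - t) * p.1 + t * q.1, (1 - t) * p.2 + t * q.2) c <= rho.
Proof.
move=> /andP[t0 t1] P Q.
have -> : distsq ((1 - t) * p.1 + t * q.1, (1 - t) * p.2 + t * q.2) c =
  (1 - t) * distsq p c + t * distsq q c - (1 - t) * t * distsq p q.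
  by rewrite /distsq /=; ring.
have := mulr_ge0 (mulr_ge0 (_ : 0 <= 1 - t) t0) (distsq_ge0 p q).
move=> /(_ ltac:(lra)); nra.
Qed.

Lemma euclidean_normE (v : plane R) (r : R) : 0 <= r ->
  (euclidean_norm v <= r) = (v.1 ^+ 2 + v.2 ^+ 2 <= r ^+ 2).
Proof.
move=> r0; rewrite /euclidean_norm -{1}(ger0_norm r0) -sqrtr_sqr ler_sqrt //.
exact: sqr_ge0.
Qed.

Lemma offsetP X (r : R) z : 0 <= r ->
  offset X r z <-> exists2 x, X x & distsq z x <= r ^+ 2.
Proof.
move=> r0; split=> [[x Xx [v vr <-]]|[x Xx zx]].
  rewrite /disk /= euclidean_normE // in vr; exists x => //; apply: le_trans vr.
  by rewrite /distsq /= !(addrC x.1, addrC x.2) !addrK.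
exists x => //; exists (z - x); last by rewrite addrC subrK.
by rewrite /disk /= euclidean_normE.
Qed.

Lemma distsq_continuous z : continuous (distsq z).
Proof.
move=> x; apply: cvgD; apply: cvgM; apply: cvgB; do ?exact: cvg_cst;
  by [exact: cvg_fst|exact: cvg_snd].
Qed.

Lemma norm_le_of_sqr (a b rho : R) : 0 <= rho -> a ^+ 2 + b ^+ 2 <= rho ^+ 2 -> `|a| <= rho.
Proof. by move=> rho0 D; rewrite ler_norml; apply/andP; split; nra. Qed.

Lemma nearest_point X z : closed X -> X !=set0 ->
  exists2 y, X y & forall x, X x -> distsq z y <= distsq z x.
Proof.
(* With the added 1, [rho ^+ 2] is at least [distsq z p], so points outside the box of half width
   [rho] are farther from [z] than [p] is. *)
move=> cX [p Xp]; pose rho := distsq z p + 1.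
have rho1 : 1 <= rho by rewrite lerDr distsq_ge0.
pose Bx := [set x : plane R | `|x.1 - z.1| <= rho /\ `|x.2 - z.2| <= rho].
have cB : compact Bx.
  have -> : Bx = `[z.1 - rho, z.1 + rho] `*` `[z.2 - rho, z.2 + rho].
    by rewrite /Bx; apply/seteqP; split=> x /=; rewrite !in_itv /= !ler_distl.
  by apply: compact_setX; exact: segment_compact.
have far x : ~ Bx x -> distsq z p < distsq z x.
  move=> nB; rewrite ltNge; apply/negP => le; apply: nB.
  have : distsq z x <= rho ^+ 2 by apply: (le_trans le); rewrite /rho; have := distsq_ge0 z p; nra.
  rewrite distsqC => D; have rho0 : 0 <= rho by lra.
  split; first exact: norm_le_of_sqr D.
  by move: D; rewrite /distsq addrC; exact: norm_le_of_sqr.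
have Bp : Bx p by apply: contrapT => /far; rewrite ltxx.
have [|||y yA ymin] := @compact_EVT_min _ R (distsq z) (X `&` Bx).
- by exists p.
- by rewrite setIC; exact: compact_closedI.
- by apply: continuous_subspaceT; exact: distsq_continuous.
have [Xy By] := set_mem yA; exists y => // x Xx.
have [Bxx|nB] := pselect (Bx x); first by apply: ymin; exact: mem_set.
by apply: (le_trans _ (ltW (far _ nB))); apply: ymin; exact: mem_set.
Qed.

Lemma closed_offset X (r : R) : 0 <= r -> closed X -> closed (offset X r).
Proof.
move=> r0 cX z cz.
have X0 : X !=set0.
  by have [|w [/(offsetP _ _ r0)[x Xx _] _]] := cz setT; [exact: filterT|exists x].
have [y Xy ymin] := nearest_point z cX X0.
apply/(offsetP _ _ r0); exists y => //; rewrite leNgt; apply/negP => lt.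
pose d := Num.sqrt (distsq z y).
have dE : d ^+ 2 = distsq z y by rewrite sqr_sqrtr // distsq_ge0.
have d0 : 0 <= d by exact: sqrtr_ge0.
have rd : r < d by rewrite -dE in lt; nra.
(* A quarter of the gap: coordinates within [e] of each other give a distance of at most [2 * e],
   here half of the gap. *)
have e0 : 0 < (d - r) / 4 by rewrite divr_gt0 // subr_gt0.
have [w [/(offsetP _ _ r0)[x Xx wx] w1 w2]] := (closure_plane _ _).1 cz _ e0.
have zw : distsq z w <= ((d - r) / 2) ^+ 2.
  rewrite distsqC; have := distsq_near (ltW w1) (ltW w2).
  by rewrite (_ : _ *+ 2 = (d - r) / 2) // mulr2n; lra.
have h0 : 0 <= (d - r) / 2 by lra.
have := distsq_triangle h0 r0 zw wx; have := ymin x Xx; rewrite -dE => D1 D2.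
have : d ^+ 2 <= ((d - r) / 2 + r) ^+ 2 by exact: le_trans D2.
nra.
Qed.

Lemma offset_interior X (r : R) z y : 0 < r -> X y -> distsq z y < r ^+ 2 ->
  (offset X r)^° z.
Proof.
move=> r0 Xy lt; pose d := Num.sqrt (distsq z y).
have dE : d ^+ 2 = distsq z y by rewrite sqr_sqrtr // distsq_ge0.
have d0 : 0 <= d by exact: sqrtr_ge0.
have rd : d < r by rewrite -dE in lt; nra.
apply/nbhs_plane; exists ((r - d) / 2); first by rewrite divr_gt0 // subr_gt0.
move=> w w1 w2; apply/(offsetP _ _ (ltW r0)); exists y => //.
have wz := distsq_near (ltW w1) (ltW w2).
have zy : distsq z y <= d ^+ 2 by rewrite dE.
have h0 : 0 <= ((r - d) / 2) *+ 2 by rewrite mulrn_wge0 // divr_ge0 // subr_ge0 ltW.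
apply: (le_trans (distsq_triangle h0 d0 wz zy)).
by rewrite (_ : _ *+ 2 + d = r) // mulr2n; lra.
Qed.

(** A point of a disk moved toward the center gets strictly inside the circle, hence into the
    interior of the offset. *)
Lemma offset_regular X (r : R) : 0 < r -> offset X r `<=` closure (offset X r)^°.
Proof.
move=> r0 z /(offsetP _ _ (ltW r0))[y Xy zy]; apply/closure_plane => e e0.
pose m := `|y.1 - z.1| + `|y.2 - z.2| + 1.
have m0 : 0 < m by rewrite ltr_wpDl // addr_ge0.
pose t := Num.min (1 / 2) (e / (m *+ 2)).
have t0 : 0 < t by rewrite lt_min !divr_gt0 //= pmulrn_lgt0.
have t1 : t <= 1 / 2 by rewrite ge_min lexx.
have te : t * m < e.
  have : t <= e / (m *+ 2) by rewrite ge_min lexx orbT.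
  rewrite ler_pdivlMr ?pmulrn_lgt0 // => H; rewrite mulr2n in H; nra.
exists (z.1 + t * (y.1 - z.1), z.2 + t * (y.2 - z.2)); split.
- apply: (offset_interior r0 Xy).
  have -> : distsq (z.1 + t * (y.1 - z.1), z.2 + t * (y.2 - z.2)) y = (1 - t) ^+ 2 * distsq z y.
    by rewrite /distsq /=; ring.
  have r2 : 0 < r ^+ 2 by rewrite exprn_gt0.
  have D := distsq_ge0 z y.
  have : (1 - t) ^+ 2 < 1 by nra.
  by have := sqr_ge0 (1 - t); nra.
- rewrite /= addrAC subrr add0r normrM (gtr0_norm t0); apply: le_lt_trans te.
  by apply: ler_wpM2l; rewrite ?ltW //; have := normr_ge0 (y.2 - z.2); rewrite /m; lra.
- rewrite /= addrAC subrr add0r normrM (gtr0_norm t0); apply: le_lt_trans te.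
  by apply: ler_wpM2l; rewrite ?ltW //; have := normr_ge0 (y.1 - z.1); rewrite /m; lra.
Qed.

Lemma interior_not_isolated X x N : closure X^° x -> nbhs x N ->
  exists y, [/\ N y, X y & y <> x].
Proof.
move=> cx Nx; have NI : nbhs x N^° by apply: open_nbhs_nbhs; split => //; exact: open_interior.
have [z [iz Nz]] := cx _ NI.
have : nbhs z (X `&` N) by apply: filterI.
move=> /nbhs_plane[e e0 He].
have [zx|] := pselect (z = x); last first.
  by move=> zx; exists z; split=> //; apply: interior_subset.
exists (z.1 + e / 2, z.2).
have [] := He (z.1 + e / 2, z.2) => /=.
- by rewrite addrAC subrr add0r gtr0_norm; lra.
- by rewrite subrr normr0.
by move=> Xw Nw; split=> // E; have := congr1 fst E; rewrite -zx /=; lra.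
Qed.

Lemma segment_not_isolated p q x N : p <> q -> segment p q x -> nbhs x N ->
  exists y, [/\ N y, segment p q y & y <> x].
Proof.
move=> pq /segmentP[t /andP[t0 t1] xE] Nx.
have : nbhs t (curve_at 1 (Line p (q.1 - p.1, q.2 - p.2)) @^-1` N).
  apply: curve_at_continuous; rewrite /= (_ : (_, _) = x) // xE; congr pair; ring.
move=> /nbhs_ballP[d /= d0 Hd].
have [u [u01 ut tu]] : exists u, [/\ 0 <= u <= 1, u <> t & `|t - u| < d].
  pose s := Num.min (d / 2) (1 / 2).
  have s0 : 0 < s by rewrite lt_min !divr_gt0.
  have sd : s <= d / 2 by rewrite ge_min lexx.
  have s1 : s <= 1 / 2 by rewrite ge_min lexx orbT.
  have d0' : 0 < d by [].
  have [th|th] := leP t (1 / 2).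
    exists (t + s); split; [lra|lra|].
    by rewrite opprD addrA subrr add0r normrN gtr0_norm; lra.
  exists (t - s); split; [lra|lra|].
  by rewrite opprB addrC subrK gtr0_norm; lra.
exists (p.1 + u * (q.1 - p.1), p.2 + u * (q.2 - p.2)); split.
- by apply: Hd; rewrite -ball_normE.
- by apply/segmentP; exists u => //; congr pair; ring.
- have D := distsq_gt0 pq; rewrite xE => E; apply: ut.
  apply: (@line_at_inj _ 1 p (q.1 - p.1, q.2 - p.2)) => /=.
    by rewrite gt_eqF // (lt_le_trans D) // /distsq; nra.
  by rewrite E; congr pair; ring.
Qed.

Lemma segment_line_local p q x (r : R) : segment p q x -> x <> p -> x <> q ->
  exists2 N, nbhs x N &
    N `&` curve_set r (Line p (q.1 - p.1, q.2 - p.2)) `<=` segment p q.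
Proof.
move=> sx xp xq.
have pq : p <> q.
  move=> pq; move: sx; rewrite -pq => /segmentP[t _ xE]; apply: xp.
  by rewrite xE [RHS]surjective_pairing; congr pair; ring.
have D := distsq_gt0 pq; rewrite /distsq in D.
pose L := (q.1 - p.1) ^+ 2 + (q.2 - p.2) ^+ 2.
have L0 : 0 < L by rewrite /L; nra.
have wk : curve_wf (Line p (q.1 - p.1, q.2 - p.2)) by rewrite /= gt_eqF.
(* [f] is the parameter of the orthogonal projection to the line: a continuous function on the plane
   that recovers the parameter of points on the line. *)
pose f (z : plane R) := ((z.1 - p.1) * (q.1 - p.1) + (z.2 - p.2) * (q.2 - p.2)) / L.
have cf : continuous f.
  move=> z; apply: cvgM; last exact: cvg_cst.
  by apply: cvgD; apply: cvgM; do ?exact: cvg_cst; apply: cvgB; do ?exact: cvg_cst;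
    [exact: cvg_fst|exact: cvg_snd].
have fE t : f (curve_at r (Line p (q.1 - p.1, q.2 - p.2)) t) = t.
  rewrite /f /= (_ : _ + _ = t * L); last by rewrite /L; ring.
  by rewrite mulfK // gt_eqF.
move/segmentP: sx => [t t01 xE].
have xE' : x = curve_at r (Line p (q.1 - p.1, q.2 - p.2)) t by rewrite xE; congr pair => /=; ring.
have t01' : 0 < t < 1.
  case/andP: t01 => t0 t1; rewrite !lt_neqAle t0 t1 !andbT; apply/andP; split; apply/eqP => tE.
    by apply: xp; rewrite xE -tE [RHS]surjective_pairing; congr pair; ring.
  by apply: xq; rewrite xE tE [RHS]surjective_pairing; congr pair; ring.
exists (f @^-1` [set u | 0 < u < 1]).
  apply: cf; rewrite xE' fE; apply/nbhs_ballP; exists (Num.min t (1 - t)).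
    by rewrite /= lt_min; lra.
  move=> u; rewrite -ball_normE /= lt_min ltr_norml => /andP[/andP[? ?]].
  by rewrite ltr_norml => /andP[? ?]; lra.
move=> z [/= fz /(line_at_surj wk)[u zE]].
rewrite zE fE in fz; rewrite zE; apply/segmentP; exists u; first lra.
by congr pair => /=; ring.
Qed.

End Distance.

Section Nearest.
Context {R : realType}.
Implicit Types (x y z p q c v : plane R) (X N M : set (plane R)).

(** A nearest point in the interior could be moved toward [z]. *)
Lemma nearest_boundary X y z : X y -> 0 < distsq z y ->
  (forall x, X x -> distsq z y <= distsq z x) -> boundary X y.
Proof.
move=> Xy D near; split; first exact: subset_closure.
move=> /nbhs_plane[e e0 He].
pose m := `|z.1 - y.1| + `|z.2 - y.2| + 1.
have m0 : 0 < m by rewrite ltr_wpDl // addr_ge0.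
pose t := Num.min (1 / 2) (e / (m *+ 2)).
have t0 : 0 < t by rewrite lt_min !divr_gt0 //= pmulrn_lgt0.
have t1 : t <= 1 / 2 by rewrite ge_min lexx.
have te : t * m < e.
  have : t <= e / (m *+ 2) by rewrite ge_min lexx orbT.
  rewrite ler_pdivlMr ?pmulrn_lgt0 // => H; rewrite mulr2n in H; nra.
have step a : `|a| <= m -> `|t * a| < e.
  move=> am; rewrite normrM (gtr0_norm t0); apply: le_lt_trans te.
  by apply: ler_wpM2l => //; exact: ltW.
have /near : X (y.1 + t * (z.1 - y.1), y.2 + t * (z.2 - y.2)).
  apply: He; rewrite /= addrAC subrr add0r; apply: step.
    by have := normr_ge0 (z.2 - y.2); rewrite /m; lra.
  by have := normr_ge0 (z.1 - y.1); rewrite /m; lra.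
have -> : distsq z (y.1 + t * (z.1 - y.1), y.2 + t * (z.2 - y.2)) = (1 - t) ^+ 2 * distsq z y.
  by rewrite /distsq /=; ring.
have : (1 - t) ^+ 2 < 1 by nra.
nra.
Qed.

(** Sliding [y] both ways along the segment shows that [z - y] is orthogonal to it, so [z] is on one
    of the two parallels at distance [rho]. The factor [s] scales the normal of [d] to length
    [rho]. *)
Lemma nearest_segment X p q y z (rho : R) : 0 < rho -> p <> q -> segment p q `<=` X ->
  segment p q y -> y <> p -> y <> q ->
  (forall x, X x -> distsq z y <= distsq z x) -> distsq z y = rho ^+ 2 ->
  let d : plane R := (q.1 - p.1, q.2 - p.2) in
  let s := rho / Num.sqrt (distsq q p) in
  curve_set rho (Line (p.1 + s * d.2, p.2 - s * d.1) d) z \/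
  curve_set rho (Line (p.1 - s * d.2, p.2 + s * d.1) d) z.
Proof.
move=> rho0 pq pqX /segmentP[t /andP[t0 t1] yE] yp yq near zy d s.
have D : 0 < distsq q p by apply: distsq_gt0; exact: nesym.
have {}t0 : 0 < t.
  rewrite lt_neqAle t0 andbT; apply/eqP => tE; apply: yp.
  by rewrite yE -tE [RHS]surjective_pairing; congr pair; ring.
have {}t1 : t < 1.
  rewrite lt_neqAle t1 andbT; apply/eqP => tE; apply: yq.
  by rewrite yE tE [RHS]surjective_pairing; congr pair; ring.
pose A := z.1 - y.1; pose B := z.2 - y.2.
pose al := A * d.1 + B * d.2; pose be := A * d.2 - B * d.1.
have dE : distsq q p = d.1 ^+ 2 + d.2 ^+ 2 by [].
have key h : 0 <= t + h <= 1 -> h * al *+ 2 <= h ^+ 2 * distsq q p.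
  move=> th; have /pqX/near : segment p q (y.1 + h * d.1, y.2 + h * d.2).
    by apply/segmentP; exists (t + h) => //; rewrite yE /d /=; congr pair; ring.
  have -> : distsq z (y.1 + h * d.1, y.2 + h * d.2) =
    distsq z y - h * al *+ 2 + h ^+ 2 * distsq q p.
    by rewrite /al /A /B dE /distsq /=; ring.
  lra.
have al0 : al = 0.
  apply/eqP; rewrite eq_le !leNgt; apply/andP; split; apply/negP => lt.
    pose h := Num.min (1 - t) (al / distsq q p).
    have h0 : 0 < h by rewrite lt_min subr_gt0 t1 divr_gt0.
    have ht : h <= 1 - t by rewrite ge_min lexx.
    have : h <= al / distsq q p by rewrite ge_min lexx orbT.
    rewrite ler_pdivlMr // => hal.
    by have := key h ltac:(lra); rewrite expr2 -mulrA -mulrnAr ler_pM2l // mulr2n; lra.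
  pose h := Num.min t (- al / distsq q p).
  have h0 : 0 < h by rewrite lt_min t0 divr_gt0 // oppr_gt0.
  have ht : h <= t by rewrite ge_min lexx.
  have : h <= - al / distsq q p by rewrite ge_min lexx orbT.
  rewrite ler_pdivlMr // => hal.
  have := key (- h) ltac:(lra).
  by rewrite sqrrN expr2 -mulrA mulNr -mulrN -mulrnAr ler_pM2l // mulr2n; lra.
pose L := Num.sqrt (distsq q p).
have L0 : 0 < L by rewrite sqrtr_gt0.
have LE : L ^+ 2 = distsq q p by rewrite sqr_sqrtr // ltW.
have sL : s * distsq q p = rho * L by rewrite -LE /s -/L expr2 mulrA divfK // gt_eqF.
have beE : be ^+ 2 = (rho * L) ^+ 2.
  rewrite exprMn LE -zy.
  have -> : be ^+ 2 = distsq z y * distsq q p - al ^+ 2.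
    by rewrite /be /al dE /distsq /A /B; ring.
  by rewrite al0; ring.
have cross : (z.1 - p.1) * d.2 - (z.2 - p.2) * d.1 = be.
  by rewrite /be /A /B yE /d /=; ring.
move/eqP: beE; rewrite eqf_sqr => /orP[/eqP E|/eqP E]; [left|right]; rewrite /curve_set /=.
  have -> : (z.1 - (p.1 + s * (q.2 - p.2))) * (q.2 - p.2) - (z.2 - (p.2 - s * (q.1 - p.1))) * (q.1 - p.1) =
    ((z.1 - p.1) * d.2 - (z.2 - p.2) * d.1) - s * distsq q p by rewrite /d /distsq /=; ring.
  by rewrite cross E sL subrr.
have -> : (z.1 - (p.1 - s * (q.2 - p.2))) * (q.2 - p.2) - (z.2 - (p.2 + s * (q.1 - p.1))) * (q.1 - p.1) =
  ((z.1 - p.1) * d.2 - (z.2 - p.2) * d.1) + s * distsq q p by rewrite /d /distsq /=; ring.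
by rewrite cross E sL addNr.
Qed.

End Nearest.

(** * Polygonal regions *)

Definition open_square (R : realType) (y : plane R) (d : R) : set (plane R) :=
  [set z | `|z.1 - y.1| < d /\ `|z.2 - y.2| < d].

Definition closed_square (R : realType) (y : plane R) (d : R) : set (plane R) :=
  [set z | `|z.1 - y.1| <= d /\ `|z.2 - y.2| <= d].

(** * Covering edges by small squares *)

Section Squares.
Context {R : realType}.
Implicit Types (x y z p q c v : plane R) (X N M : set (plane R)).

Lemma nbhs_open_square y (d : R) : 0 < d -> nbhs y (open_square y d).
Proof. by move=> d0; apply/nbhs_plane; exists d. Qed.

Lemma open_square_interior y (d : R) : open_square y d `<=` (closed_square y d)^°.
Proof.
move=> z [z1 z2]; apply/nbhs_plane.
exists (Num.min (d - `|z.1 - y.1|) (d - `|z.2 - y.2|)).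
  by rewrite lt_min !subr_gt0 z1 z2.
move=> w; rewrite !lt_min => /andP[w1 _] /andP[_ w2]; split.
  by have := ler_normD (w.1 - z.1) (z.1 - y.1); rewrite addrA subrK; lra.
by have := ler_normD (w.2 - z.2) (z.2 - y.2); rewrite addrA subrK; lra.
Qed.

Lemma compact_closed_square y (d : R) : compact (closed_square y d).
Proof.
have -> : closed_square y d = `[y.1 - d, y.1 + d] `*` `[y.2 - d, y.2 + d].
  rewrite /closed_square; apply/seteqP; split=> x /=; by rewrite !in_itv /= !ler_distl.
by apply: compact_setX; exact: segment_compact.
Qed.

Lemma closed_closed_square y (d : R) : closed (closed_square y d).
Proof. by apply: compact_closed; [exact: plane_hausdorff|exact: compact_closed_square]. Qed.

Definition square_sides y (d : R) : set (curve R) :=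
  [set Line (y.1 + d, 0) (0, 1); Line (y.1 - d, 0) (0, 1)] `|`
  [set Line (0, y.2 + d) (1, 0); Line (0, y.2 - d) (1, 0)].

Lemma square_sidesP y (d r : R) z : closed_square y d z -> ~ open_square y d z ->
  exists2 k, square_sides y d k & curve_set r k z.
Proof.
move=> [z1 z2] no.
have [e1|ne1] := pselect (`|z.1 - y.1| = d).
  have [le|le] := leP 0 (z.1 - y.1).
    exists (Line (y.1 + d, 0) (0, 1)); first by left; left.
    by move: e1; rewrite /curve_set /= ger0_norm //; lra.
  exists (Line (y.1 - d, 0) (0, 1)); first by left; right.
  by move: e1; rewrite /curve_set /= ltr0_norm //; lra.
have [e2|ne2] := pselect (`|z.2 - y.2| = d).
  have [le|le] := leP 0 (z.2 - y.2).
    exists (Line (0, y.2 + d) (1, 0)); first by right; left.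
    by move: e2; rewrite /curve_set /= ger0_norm //; lra.
  exists (Line (0, y.2 - d) (1, 0)); first by right; right.
  by move: e2; rewrite /curve_set /= ltr0_norm //; lra.
by case: no; split; rewrite lt_neqAle; apply/andP; split=> //; apply/eqP.
Qed.

Lemma path_square_cover (f : R -> plane R) (a b d : R) : continuous f -> 0 < d ->
  exists Y, [/\ finite_set Y, Y `<=` f @` `[a, b] &
    f @` `[a, b] `<=` \bigcup_(y in Y) open_square y d].
Proof.
move=> cf d0; have : cover_compact `[a, b].
  by rewrite -compact_cover; exact: segment_compact.
move=> /(_ _ `[a, b]%classic (fun t => (f @^-1` open_square (f t) d)^°))[||D Dab cov].
- by move=> t _; exact: open_interior.
- by move=> t tab; exists t => //; apply: cf; exact: nbhs_open_square.
exists (f @` [set` D]); split.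
- by apply: finite_image; exact: finite_fset.
- by move=> _ [t tD <-]; exists t => //; exact: set_mem (Dab t tD).
- move=> _ [t tab <-]; have [u Du /interior_subset tu] := cov t tab.
  by exists (f u) => //; exists u.
Qed.

Lemma edge_square_cover (r d : R) (g : edge R) : 0 < d ->
  exists Y, [/\ finite_set Y, Y `<=` edge_set r g &
    edge_set r g `<=` \bigcup_(y in Y) open_square y d].
Proof.
move=> d0; case: g => [p q|c a b] /=.
  rewrite segment_image; apply: path_square_cover => //.
  by apply: continuous_pair; exact: continuous_affine.
exact: path_square_cover (@curve_at_continuous _ r (Circle c)) d0.
Qed.

(** Serves to keep something of the region in each removed square: a segment rather than a point,
    since a polygonal boundary has no isolated points. *)
Lemma small_segment X y (d : R) : closure X^° y -> 0 < d ->
  exists s : plane R * plane R, [/\ s.1 <> s.2, segment s.1 s.2 `<=` X &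
    segment s.1 s.2 `<=` open_square y d].
Proof.
move=> cy d0.
have NI : nbhs y (open_square y d)^°.
  by apply: open_nbhs_nbhs; split; [exact: open_interior|exact: nbhs_open_square].
have [z [iz sz]] := cy _ NI.
have : nbhs z (X `&` open_square y d) by apply: filterI.
move=> /nbhs_plane[h h0 Hh]; pose w : plane R := (z.1 + h / 2, z.2).
have w1 : `|w.1 - z.1| < h by rewrite /w /= addrAC subrr add0r gtr0_norm; lra.
have w2 : `|w.2 - z.2| < h by rewrite subrr normr0.
have sub x : segment z w x -> (X `&` open_square y d) x.
  by move=> /(segment_square _ _ w1 w2)[]; rewrite ?subrr ?normr0 // => x1 x2; exact: Hh.
exists (z, w); split=> /=.
- by move=> E; have := congr1 fst E; rewrite /w /=; lra.
- by move=> x /sub[].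
- by move=> x /sub[].
Qed.

End Squares.

Section PolygonalArrangement.
Context {R : realType}.
Implicit Types (x y z p q c v : plane R) (X N M : set (plane R)).

Lemma segment_line p q z (r : R) : segment p q z ->
  curve_set r (Line p (q.1 - p.1, q.2 - p.2)) z.
Proof. by move=> /segmentP[t _ ->]; rewrite /curve_set /=; ring. Qed.

Lemma line_wf p q : p <> q -> curve_wf (Line p (q.1 - p.1, q.2 - p.2)).
Proof.
move=> pq; have := distsq_gt0 (nesym pq); rewrite /distsq /= => D.
by rewrite gt_eqF.
Qed.

Lemma segment_interior_sub p q : segment_interior p q `<=` segment p q.
Proof.
by move=> z [t /=]; rewrite in_itv /= => /andP[/ltW t0 /ltW t1] <-; exists t; rewrite //= in_itv /= t0.
Qed.

Lemma segment_interior_end p q z : p <> q -> segment_interior p q z -> z <> p /\ z <> q.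
Proof.
move=> pq [t /=]; rewrite in_itv /= => /andP[t0 t1] zE.
have wk := line_wf pq; pose k := Line p (q.1 - p.1, q.2 - p.2).
have at_ u : ((1 - u) * p.1 + u * q.1, (1 - u) * p.2 + u * q.2) = curve_at 1 k u.
  by congr pair => /=; ring.
have zE' : z = curve_at 1 k t by rewrite -zE -at_.
split=> zE2.
  have : curve_at 1 k t = curve_at 1 k 0.
    by rewrite -zE' zE2 /= !mul0r !addr0 -surjective_pairing.
  by move/(line_at_inj wk); lra.
have : curve_at 1 k t = curve_at 1 k 1.
  by rewrite -zE' zE2 /= !mul1r [LHS]surjective_pairing; congr pair; ring.
by move/(line_at_inj wk); lra.
Qed.

(** Outside the segments of [S], [X] is in the closure of its interior, so the set [W] of
    [arrangement] consists of the ends of these segments. The radius 1 is arbitrary, as no circle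
    occurs. *)
Lemma polygonal_of_lines (O : set (plane R)) (S : set (plane R * plane R))
    (K : set (curve R)) :
  let X := closure O `|` \bigcup_(s in S) segment s.1 s.2 in
  open O -> finite_set S -> (forall s, S s -> s.1 <> s.2) ->
  finite_set K -> (forall k, K k -> curve_wf k /\ exists p d, k = Line p d) ->
  (forall x, boundary X x ->
     (\bigcup_(s in S) segment s.1 s.2) x \/ exists2 k, K k & curve_set 1 k x) ->
  (exists2 m : R, 0 <= m & forall x, boundary X x -> `|x.1| <= m /\ `|x.2| <= m) ->
  polygonal_region X.
Proof.
move=> X oO fS Snd fK KL bX [m m0 Xm].
pose ln (s : plane R * plane R) := Line s.1 (s.2.1 - s.1.1, s.2.2 - s.1.2).
have OX : O `<=` X^°.
  by rewrite -open_subsetE // => x Ox; left; exact: subset_closure.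
have cS : closed (\bigcup_(s in S) segment s.1 s.2).
  by apply: closed_bigcup_finite => // s _; exact: closed_segment.
have cX : closed X by apply: closedU => //; exact: closed_closure.
have reg x : X x -> closure X^° x \/ (\bigcup_(s in S) segment s.1 s.2) x.
  by move=> [cx|sx]; [left; exact: closure_subset cx|right].
pose W := (fst @` S) `|` (snd @` S).
have [||||||||||n [e [e1 e2 e3 e4]]] := @arrangement R 1 X (K `|` ln @` S) W m.
- exact: ltr01.
- exact: cX.
- move=> x N /reg[cx|[s Ss sx]] Nx; first exact: interior_not_isolated.
  have [y [Ny sy yx]] := segment_not_isolated (Snd _ Ss) sx Nx.
  by exists y; split=> //; right; exists s.
- by rewrite finite_setU; split=> //; exact: finite_image.
- by move=> k [/KL[]//|[s Ss <-]]; apply: line_wf; exact: Snd.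
- move=> x /bX[[s Ss sx]|[k Kk kx]]; last by exists k => //; left.
  by exists (ln s); [right; exists s|exact: segment_line].
- exact: m0.
- exact: Xm.
- by rewrite finite_setU; split; exact: finite_image.
- move=> x bx nW; have [|[s Ss sx]] := reg _ (boundary_closed cX bx); [by left|right].
  exists (ln s); first by split; [right; exists s|exact: segment_line].
  have [||N Nx NS] := @segment_line_local _ s.1 s.2 x 1 sx.
  - by move=> xs; apply: nW; left; exists s.
  - by move=> xs; apply: nW; right; exists s.
  by exists N => // z /NS sz; right; exists s.
have seg i : exists s, e i = Segment s.1 s.2.
  case ei : (e i) => [p q|c a b]; first by exists (p, q).
  by exfalso; case: (e4 _ _ _ _ ei) => [/KL[_ [p [d //]]]|[s _ //]].
have [f fP] := choice seg.
exists n, (fun i => (f i).1), (fun i => (f i).2).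
have nd i : (f i).1 <> (f i).2 by have := e1 i; rewrite fP.
split=> //.
  by rewrite e2; apply: eq_bigcupr => i _; rewrite fP.
move=> i j ij; apply/seteqP; split=> // z [zi zj].
have := e3 i j ij z; rewrite !fP /=.
case=> [|zE _]; first by split; exact: segment_interior_sub.
by have [z1 z2] := segment_interior_end (nd i) zi; case: zE.
Qed.

End PolygonalArrangement.

(** * Indented regions *)

Section IndentedRegion.
Context {R : realType} (r : R) (P : set (plane R)) (n : nat) (e : 'I_n -> edge R).
Implicit Types (x y z p q c v : plane R) (X N M : set (plane R)).
Hypothesis r0 : 0 < r.
Hypothesis cP : closed P.
Hypothesis nondeg : forall i, edge_nondegenerate (e i).
Hypothesis bP : boundary P = \bigcup_i edge_set r (e i).
Hypothesis meet : forall i j, i <> j ->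
  edge_set r (e i) `&` edge_set r (e j) `<=` edge_ends r (e i) `&` edge_ends r (e j).
Hypothesis dents : forall i c a b, e i = Arc c a b ->
  Defs.arc c r a b `<=` closure P^° /\ dent P (Defs.arc c r a b).

Lemma edge_in_region i : edge_set r (e i) `<=` P.
Proof. by move=> x ix; apply: boundary_closed => //; rewrite bP; exists i. Qed.

Lemma dent_outside i c a b t : e i = Arc c a b -> a < t < b ->
  exists2 M, nbhs (circle_point c r t) M &
    forall z, M z -> 0 < curve_eq r (Circle c) z -> P z.
Proof.
move=> ei /andP[at_ tb]; have := nondeg i; rewrite ei /= => /andP[ab ba].
set x := circle_point c r t.
pose U := \bigcup_(j in [set j | j <> i]) edge_set r (e j).
have cU : closed U.
  apply: closed_bigcup_finite => [|j _]; [exact: finite_finset|exact: edge_set_closed].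
have ix : edge_set r (e i) x by rewrite ei /=; exists t; rewrite //= in_itv /= !ltW.
have nU : ~ U x.
  move=> [j ji jx]; have [] := meet (nesym ji) (conj ix jx).
  rewrite ei /= => -[] /(circle_point_inj r0) E _; have := E ltac:(rewrite ltr_norml; lra); lra.
have kx := @curve_at_in _ r (Circle c) t; rewrite [curve_at _ _ _]/= -/x in kx.
have bx : boundary P x by rewrite bP; exists i.
have [M [oM Mx Mp Mn]] := @side_dichotomy _ r (Circle c) x P (~` U) r0 I kx
  (open_nbhs_nbhs (conj (closed_openC cU) nU)) (ltac:(move=> z nUz; rewrite bP => -[j _ jz];
    have [ji|ji] := pselect (j = i);
      [by move: jz; rewrite ji ei => /arc_sub_circle | by case: nUz; exists j])).
have nM : nbhs x M by exact: open_nbhs_nbhs.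
(* If the outside is not in [P], the inside cannot be out as well, because the arc is in the closure
   of the interior; and if it is in, a short chord of the arc contradicts the dent. *)
case: Mp => Mp; first by exists M.
case: Mn => Mn; last first.
  have [ci _] := dents ei; exfalso.
  by apply: (@both_sides_out _ r (Circle c) x P M r0 I oM Mx Mp Mn); apply: ci; rewrite ei in ix.
exfalso; move: nM => /nbhs_plane[s s0 Ms].
have : nbhs t (circle_point c r @^-1` [set z | `|z.1 - x.1| < s /\ `|z.2 - x.2| < s]).
  apply: (@curve_at_continuous _ r (Circle c)); apply/nbhs_plane; by exists s.
move=> /nbhs_ballP[d /= d0 Hd].
(* The angle [t + h] gives a second point of the arc, close enough to [x] for the chord to stay in
   [M]. *)
pose h := Num.min (d / 2) ((b - t) / 2).
have h0 : 0 < h by rewrite lt_min !divr_gt0 // subr_gt0.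
have hd : h <= d / 2 by rewrite ge_min lexx.
have hb : h <= (b - t) / 2 by rewrite ge_min lexx orbT.
have [y1 y2] : `|(circle_point c r (t + h)).1 - x.1| < s /\ `|(circle_point c r (t + h)).2 - x.2| < s.
  by apply: Hd; rewrite -ball_normE /= opprD addrA subrr add0r normrN gtr0_norm //; lra.
set y := circle_point c r (t + h) in y1 y2.
have yarc : Defs.arc c r a b y by exists (t + h); rewrite //= in_itv /=; apply/andP; split; lra.
have xarc : Defs.arc c r a b x by rewrite ei in ix.
have xy : x <> y.
  by move=> /(circle_point_inj r0) E; have := E ltac:(rewrite ltr_norml; lra); lra.
have [_ /(_ x y xarc yarc xy)] := dents ei; apply => z sz.
have [z1 z2] : `|z.1 - x.1| < s /\ `|z.2 - x.2| < s.
  by apply: segment_square sz => //; rewrite subrr normr0.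
move/segmentP: sz => [w /andP[w0 w1] zE].
have [->|/eqP zx] := pselect (z = x); first exact: boundary_closed bx.
have [->|/eqP zy] := pselect (z = y).
  by apply: (@edge_in_region i); rewrite ei.
have {}w0 : 0 < w.
  rewrite lt_neqAle w0 andbT eq_sym; apply: contra_neq zx => wE.
  by rewrite zE wE [RHS]surjective_pairing; congr pair; ring.
have {}w1 : w < 1.
  rewrite lt_neqAle w1 andbT; apply: contra_neq zy => wE.
  by rewrite zE wE [RHS]surjective_pairing; congr pair; ring.
apply: Mn; first exact: Ms.
have ky := arc_sub_circle yarc.
move: kx ky; rewrite /curve_set /= => kx ky.
have -> : (z.1 - c.1) ^+ 2 + (z.2 - c.2) ^+ 2 - r ^+ 2 =
  (1 - w) * ((x.1 - c.1) ^+ 2 + (x.2 - c.2) ^+ 2 - r ^+ 2) +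
  w * ((y.1 - c.1) ^+ 2 + (y.2 - c.2) ^+ 2 - r ^+ 2) - (1 - w) * w * distsq x y.
  by rewrite zE /distsq /=; ring.
rewrite kx ky !mulr0 add0r sub0r oppr_lt0 mulr_gt0 ?mulr_gt0 ?subr_gt0 //.
rewrite lt_neqAle addr_ge0 ?sqr_ge0 // andbT eq_sym paddr_eq0 ?sqr_ge0 // !sqrf_eq0 !subr_eq0.
by apply/negP => /andP[/eqP E1 /eqP E2]; apply: xy; rewrite [x]surjective_pairing [y]surjective_pairing E1 E2.
Qed.

(** If no straight edge contains [v], the segment is taken on the tangent of the dent at [v]. No
    edge enters the gap between the arc and its tangent near [v], and the gap is in [P] since it
    borders the dent from outside. *)
Lemma touching_segment i c a b v : e i = Arc c a b -> edge_ends r (e i) v ->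
  exists p q, [/\ p <> q, segment p q v & segment p q `<=` P].
Proof.
move=> ei endv; have r0' := r0.
have [[j [p [q [ej jv]]]]|noseg] := pselect (exists j p q, e j = Segment p q /\ segment p q v).
  exists p, q; split=> //; first by have := nondeg j; rewrite ej.
  by have := @edge_in_region j; rewrite ej.
have Pv : P v by apply: (@edge_in_region i); exact: edge_end_in.
have := nondeg i; rewrite ei /= => /andP[ab _].
have := endv; rewrite ei => /(arc_end_frame ab)[m [sg [m1 vE sgE param]]].
pose gap j (eta : R) := forall s t : R, `|s| = eta -> - (s ^+ 2) <= r * t -> t <= 0 ->
  0 < s ^+ 2 + t ^+ 2 + r * t *+ 2 -> ~ edge_set r (e j) (frame v m s t).
have [eta eta0 gapP] : exists2 h : R, 0 < h & forall t j, 0 < t < h -> gap j t.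
  apply: finite_common_bound => j.
  have [jv|njv] := pselect (edge_set r (e j) v).
    case ej : (e j) jv => [p q|c' a' b'] jv; first by exfalso; apply: noseg; exists j, p, q.
    have [h h0 Hh] := tangent_gap_circle r0 m1 (arc_sub_circle jv).
    exists h => // eta ? s t sE st t0 F; rewrite ej => /arc_sub_circle.
    by apply: Hh => //; rewrite sE.
  (* An edge that misses [v] misses a square around it, which contains the gap for small [eta]
     because [- t <= eta] there. *)
  have /nbhs_plane[d d0 Hd] : nbhs v (~` edge_set r (e j)).
    by apply: open_nbhs_nbhs; split=> //; apply: closed_openC; exact: edge_set_closed.
  exists (Num.min r (d / 2)); first by rewrite lt_min r0 divr_gt0.
  move=> eta; rewrite lt_min => /and3P[eta0 etar etad] s t sE st t0 _.
  have [] := @frame_near _ v m d s t m1; last by move=> ? ? ?; exact: (Hd (frame v m s t)).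
  have s2 : s ^+ 2 = eta ^+ 2 by rewrite -sE real_normK // num_real.
  rewrite sE ler0_norm //.
  have : - t <= eta by rewrite -(ler_pM2l r0); nra.
  by lra.
have [h [h12 /andP[sh0 sh1] ch]] := @small_angle _ r (b - a) eta r0' ltac:(lra) eta0.
have [t tab tE] := param h h12.
have [M /nbhs_plane[d d0 Md] MP] := dent_outside ei tab.
rewrite tE in Md.
pose s1 := sg * (r * sin h); pose t1 := r * cos h - r.
have s1n : `|s1| = r * sin h.
  by rewrite normrM (gtr0_norm sh0); case: sgE => ->; rewrite ?normrN normr1 mul1r.
have s1E : s1 ^+ 2 = - (t1 ^+ 2) - r * t1 *+ 2.
  rewrite -(real_normK (num_real s1)) s1n /t1; have := cos2Dsin2 h.
  move: (cos h) (sin h) => C S CS.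
  have -> : (r * S) ^+ 2 = r ^+ 2 * (C ^+ 2 + S ^+ 2) - r ^+ 2 * C ^+ 2 by ring.
  by rewrite CS; ring.
have s10 : 0 < s1 ^+ 2 by rewrite -(real_normK (num_real s1)) s1n exprn_gt0.
(* This is where [0 <= cos h] is used; it yields the bound [- (s1 ^+ 2) <= r * t1] required by the
   gap. *)
have t1r : - r <= t1 by rewrite /t1; nra.
have t10 : t1 < 0 by nra.
have gapin s u z : 0 < `|s| -> `|s| <= r * sin h -> - (s ^+ 2) <= r * u -> u <= 0 ->
    0 < s ^+ 2 + u ^+ 2 + r * u *+ 2 -> z = frame v m s u -> ~ boundary P z.
  move=> s0 sle su u0 F ->; rewrite bP => -[j _]; apply: (gapP `|s| j) => //.
  by rewrite s0 (le_lt_trans sle).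
(* [k] lifts the arc point off the circle, within the neighborhood whose outer part is in [P], and
   not beyond the tangent. *)
pose k := Num.min (d / 2) (- t1).
have k0 : 0 < k by rewrite lt_min divr_gt0 //= oppr_gt0.
have kd : k <= d / 2 by rewrite ge_min lexx.
have kt : k <= - t1 by rewrite ge_min lexx orbT.
pose z := frame v m s1 (t1 + k); pose q0 := frame v m s1 0.
have Pz : P z.
  have m11 := norm_le1_of_sqr m1; have m21 : `|m.2| <= 1 by apply: (@norm_le1_of_sqr _ _ m.1); rewrite addrC.
  apply: MP.
    apply: Md; rewrite /z /frame -/s1 -/t1 /=.
      have -> : v.1 - s1 * m.2 + (t1 + k) * m.1 - (v.1 - s1 * m.2 + t1 * m.1) = k * m.1 by ring.
      by rewrite normrM (gtr0_norm k0); have := ler_piMr (ltW k0) m11; lra.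
    have -> : v.2 + s1 * m.1 + (t1 + k) * m.2 - (v.2 + s1 * m.1 + t1 * m.2) = k * m.2 by ring.
    by rewrite normrM (gtr0_norm k0); have := ler_piMr (ltW k0) m21; lra.
  rewrite /z /frame vE /=.
  have -> : (c.1 + r * m.1 - s1 * m.2 + (t1 + k) * m.1 - c.1) ^+ 2 +
     (c.2 + r * m.2 + s1 * m.1 + (t1 + k) * m.2 - c.2) ^+ 2 - r ^+ 2 =
     ((r + t1 + k) ^+ 2 + s1 ^+ 2) * (m.1 ^+ 2 + m.2 ^+ 2) - r ^+ 2 by ring.
  by rewrite m1 s1E; nra.
(* Membership in [P] propagates through the gap, first from [z] along the normal to [q0] on the
   tangent, later from [q0] along the tangent toward [v]. *)
have Pq : P q0.
  apply: segment_side_end Pz; apply/seteqP; split=> // x [/frame_segment[w /andP[w0 w1] xE]].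
  have uw : t1 < (1 - w) * (t1 + k).
    by have := mulr_ge0 w0 (_ : 0 <= - (t1 + k)); move=> /(_ ltac:(lra)); lra.
  have ruw : r * t1 <= r * ((1 - w) * (t1 + k)) by rewrite ler_pM2l // ltW.
  have t1t1 : t1 * t1 + r * t1 *+ 2 <= r * t1.
    by have := mulr_le0_ge0 (ltW t10) (_ : 0 <= t1 + r); move=> /(_ ltac:(lra)); lra.
  apply: (gapin s1 ((1 - w) * (t1 + k))) => //.
  - by rewrite s1n.
  - by rewrite s1n.
  - by rewrite s1E expr2; lra.
  - by rewrite mulr_ge0_le0 // ?subr_ge0 //; lra.
  - have -> : s1 ^+ 2 + ((1 - w) * (t1 + k)) ^+ 2 + r * ((1 - w) * (t1 + k)) *+ 2 =
      ((1 - w) * (t1 + k) - t1) * ((1 - w) * (t1 + k) + t1 + r *+ 2) by rewrite s1E; ring.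
    by apply: mulr_gt0; lra.
  - by rewrite xE; congr (frame v m); ring.
have vF : v = frame v m 0 0 by rewrite [LHS]surjective_pairing /frame; congr pair; ring.
exists v, q0; split.
- move=> vq; have : distsq v q0 = s1 ^+ 2 * (m.1 ^+ 2 + m.2 ^+ 2).
    by rewrite /distsq /q0 /frame /=; ring.
  rewrite -vq m1 mulr1 /distsq !subrr expr0n /= addr0 => E.
  by rewrite -E ltxx in s10.
- exact: segment_left.
- move=> x; rewrite {1}vF => /frame_segment[w /andP[]]; rewrite le_eqVlt => /orP[/eqP <-|w0] w1.
    by rewrite subr0 !mulr0 !mul0r !addr0 -vF => ->.
  rewrite !mulr0 !add0r => xE; apply: segment_side_end Pq.
  rewrite xE; apply/seteqP; split=> // y [/frame_segment[w' /andP[w0' w1'] yE]].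
  have f0 : 0 < (1 - w') + w' * w by nra.
  have f1 : (1 - w') + w' * w <= 1 by nra.
  apply: (gapin (((1 - w') + w' * w) * s1) 0) => //.
  - by rewrite normrM mulr_gt0 ?s1n // gtr0_norm.
  - by rewrite normrM s1n (gtr0_norm f0) ler_piMl // ltW.
  - by rewrite mulr0 oppr_le0 sqr_ge0.
  - by rewrite mulr0 mul0rn addr0 expr0n /= addr0 exprMn mulr_gt0 // exprn_gt0.
  - by rewrite yE; congr (frame v m); ring.
Qed.

Lemma nearest_on_edge y z : P y -> r ^+ 2 < distsq z y ->
  (forall x, P x -> distsq z y <= distsq z x) ->
  (exists i p q, e i = Segment p q /\ segment p q y) \/
  (exists i c a b, e i = Arc c a b /\ edge_ends r (e i) y).
Proof.
move=> Py far near; have r2 : 0 < r ^+ 2 by rewrite exprn_gt0.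
have := nearest_boundary Py (lt_trans r2 far) near; rewrite bP => -[i _].
case ei : (e i) => [p q|c a b] iy; first by left; exists i, p, q.
right; exists i, c, a, b; split=> //; rewrite ei.
case: (iy) => t /=; rewrite in_itv /= => /andP[].
rewrite le_eqVlt => /orP[/eqP <- _ <-|at_]; first by left.
rewrite le_eqVlt => /orP[/eqP -> <-|tb tE]; first by right.
have tab : a < t < b by rewrite at_.
have := dent_outside ei tab; rewrite tE => out.
by have := nearest_outside r0 (arc_sub_circle iy) out near; rewrite leNgt far.
Qed.

Lemma compact_boundary : compact (boundary P).
Proof.
rewrite bP; apply: compact_bigcup_finite => [|i _]; first exact: finite_finset.
exact: edge_set_compact.
Qed.

Lemma offset_bulged (rho : R) : r < rho -> bulged_region rho (offset P rho).
Proof.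
move=> rrho; have r0' := r0; have rho0 : 0 < rho by lra.
have rho2 : r ^+ 2 < rho ^+ 2 by nra.
have cQ : closed (offset P rho) by exact: closed_offset (ltW rho0) cP.
split=> //.
have [m m0 Pm] := compact_plane_bounded compact_boundary.
pose par p q : set (curve R) :=
  let d : plane R := (q.1 - p.1, q.2 - p.2) in
  let s := rho / Num.sqrt (distsq q p) in
  [set Line (p.1 + s * d.2, p.2 - s * d.1) d; Line (p.1 - s * d.2, p.2 + s * d.1) d].
(* A boundary point of the offset is at distance exactly [rho] from its nearest point in [P], which
   is on a straight edge or at an end of a dent; these are the possible loci. *)
pose K := \bigcup_i (match e i with
  | Segment p q => par p q `|` [set Circle p; Circle q]
  | Arc c a b => [set Circle (circle_point c r a); Circle (circle_point c r b)] end).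
have near z : boundary (offset P rho) z -> exists y,
    [/\ P y, boundary P y, distsq z y = rho ^+ 2 &
        forall x, P x -> distsq z y <= distsq z x].
  move=> bz; have [y' Py' zy'] := (offsetP _ _ (ltW rho0)).1 (boundary_closed cQ bz).
  have [y Py ymin] := nearest_point z cP (ex_intro _ y' Py').
  have zy : distsq z y = rho ^+ 2.
    apply/eqP; rewrite eq_le (le_trans (ymin _ Py') zy') leNgt; apply/negP => lt.
    by case: bz => _; apply; exact: offset_interior Py lt.
  exists y; split=> //; apply: (nearest_boundary Py _ ymin).
  by rewrite zy exprn_gt0.
(* No exceptional points here: an offset has no one-dimensional pieces by [offset_regular]. *)
have [||||||||||N [f [f1 f2 f3 f4]]] := @arrangement R rho (offset P rho) K set0 (m + rho).
- exact: rho0.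
- exact: cQ.
- by move=> x N Qx; apply: interior_not_isolated; exact: offset_regular.
- apply: bigcup_finite => [|i _]; first exact: finite_finset.
  case: (e i) => [p q|c a b]; last exact: finite_set2.
  by rewrite finite_setU; split; exact: finite_set2.
- move=> k [i _]; have := nondeg i; case: (e i) => [p q|c a b] /=; last by move=> _ [->|->].
  move=> pq; have D : distsq q p != 0 by rewrite gt_eqF // distsq_gt0 //; exact: nesym.
  by move=> [[->|->]|[->|->]].
- move=> z /near[y [Py _ zy ymin]].
  have far : r ^+ 2 < distsq z y by rewrite zy.
  have onc x : distsq z x = rho ^+ 2 -> curve_set rho (Circle x) z.
    by rewrite /curve_set /distsq /= => ->; rewrite subrr.
  have [[i [p [q [ei sy]]]]|[i [c [a [b [ei]]]]]] := nearest_on_edge Py far ymin.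
    have [yp|yp] := pselect (y = p).
      exists (Circle p); last by apply: onc; rewrite -yp.
      by exists i => //; rewrite ei; right; left.
    have [yq|yq] := pselect (y = q).
      exists (Circle q); last by apply: onc; rewrite -yq.
      by exists i => //; rewrite ei; right; right.
    have pq : p <> q by have := nondeg i; rewrite ei.
    have pqP : segment p q `<=` P by have := @edge_in_region i; rewrite ei.
    have [zs|zs] := nearest_segment rho0 pq pqP sy yp yq ymin zy.
      by eexists; last exact: zs; exists i => //; rewrite ei; left; left.
    by eexists; last exact: zs; exists i => //; rewrite ei; left; right.
  rewrite ei /= => -[yE|yE].
    exists (Circle (circle_point c r a)); last by apply: onc; rewrite -yE.
    by exists i => //; rewrite ei; left.
  exists (Circle (circle_point c r b)); last by apply: onc; rewrite -yE.
  by exists i => //; rewrite ei; right.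
- by rewrite addr_ge0 // ltW.
- move=> z /near[y [_ by_ zy _]]; have [y1 y2] := Pm _ by_.
  have {}zy : distsq z y <= rho ^+ 2 by rewrite zy.
  have z1 : `|z.1 - y.1| <= rho by exact: (norm_le_of_sqr (ltW rho0) zy).
  have z2 : `|z.2 - y.2| <= rho.
    by move: zy; rewrite /distsq addrC; exact: (norm_le_of_sqr (ltW rho0)).
  split.
    by have := ler_normD (z.1 - y.1) y.1; rewrite subrK; lra.
  by have := ler_normD (z.2 - y.2) y.2; rewrite subrK; lra.
- exact: finite_set0.
- by move=> z bz _; left; apply: offset_regular => //; exact: boundary_closed bz.
exists N, f; split=> // i c a b fi; split.
  move=> z iz; apply: offset_regular => //; apply: boundary_closed => //.
  by rewrite f2; exists i => //; rewrite fi.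
(* The circles of [K] are centered at ends of edges, so the disk of radius [rho] about [c] is in the
   offset and contains the chords of the arc. *)
have Pc : P c.
  have [j _] := f4 _ _ _ _ fi; have nj := nondeg j; have jP := @edge_in_region j.
  have end_ := edge_end_in (r := r) nj; case: (e j) jP end_ {nj} => [p q|c' a' b'] jP end_.
    by move=> [[//|//]|[[->]|[->]]]; apply/jP/end_; [left|right].
  by move=> [[->]|[->]]; apply/jP/end_; [left|right].
have disc w : curve_set rho (Circle c) w -> distsq w c <= rho ^+ 2.
  by rewrite /curve_set /distsq /=; lra.
have := f1 i; rewrite fi /= => /andP[ab ba] dn.
pose h := (a + b) / 2.
apply: (dn (circle_point c rho a) (circle_point c rho h)).
- by exists a => //=; rewrite in_itv /= lexx ltW.
- by exists h => //=; rewrite in_itv /= /h; lra.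
- by move/(circle_point_inj rho0); rewrite ltr_norml /h => H; have := H ltac:(lra); lra.
- move=> z /segmentP[t t01 ->]; apply/(offsetP _ _ (ltW rho0)); exists c => //.
  by apply: distsq_convex => //; apply: disc; exact: (@curve_at_in _ rho (Circle c)).
Qed.

(** If the nearest point of [P] is within [r] of [z], density supplies a point of [X] within
    [r + (rho - r)]; otherwise the nearest point is on a straight edge or at an end of a dent, hence
    in [X]. *)
Lemma offset_dense_subset (rho : R) X : r < rho -> X `<=` P ->
  (forall i p q, e i = Segment p q -> segment p q `<=` X) ->
  (forall i c a b, e i = Arc c a b -> edge_ends r (e i) `<=` X) ->
  (forall x, P x -> exists2 y, X y & distsq x y <= (rho - r) ^+ 2) ->
  offset P rho = offset X rho.
Proof.
move=> rrho XP segX endX dense; have r0' := r0; have rho0 : 0 <= rho by lra.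
apply/seteqP; split=> z /(offsetP _ _ rho0)[x Px zx]; apply/(offsetP _ _ rho0); last first.
  by exists x => //; exact: XP.
have [y Py ymin] := nearest_point z cP (ex_intro _ x Px).
have zy := le_trans (ymin _ Px) zx.
have [near|far] := leP (distsq z y) (r ^+ 2).
  have [w Xw yw] := dense y Py; exists w => //.
  have d0 : 0 <= rho - r by lra.
  by have := distsq_triangle (ltW r0) d0 near yw; rewrite addrC subrK.
exists y => //.
have [[i [p [q [ei sy]]]]|[i [c [a [b [ei iy]]]]]] := nearest_on_edge Py far ymin.
  exact: (segX _ _ _ ei _ sy).
exact: (endX _ _ _ _ ei _ iy).
Qed.

Lemma polygonal_core (rho : R) : r < rho ->
  exists X, [/\ polygonal_region X, X `<=` P & offset P rho = offset X rho].
Proof.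
move=> rrho; have r0' := r0.
(* Two points of a square of half width [d] differ by at most [2 * d] in each coordinate, so their
   distance is at most [4 * d = rho - r]. *)
pose d := (rho - r) / 4; have d0 : 0 < d by rewrite divr_gt0 // subr_gt0.
pose isarc := [set i | exists c a b, e i = Arc c a b].
pose G := \bigcup_(i in isarc) edge_set r (e i).
have [Z ZP] := choice (fun i => @edge_square_cover _ r d (e i) d0).
pose Y := \bigcup_(i in isarc) Z i.
have fY : finite_set Y.
  by apply: bigcup_finite => [|i _]; [exact: finite_finset|have [] := ZP i].
have YG : Y `<=` G by move=> y [i ai yi]; exists i => //; have [_ +_] := ZP i; apply.
have GY : G `<=` \bigcup_(y in Y) open_square y d.
  move=> x [i ai xi]; have [_ _ H] := ZP i; have [y yi xy] := H x xi.
  by exists y => //; exists i.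
have Gint y : G y -> closure P^° y.
  by move=> [i [c [a [b ei]]]]; have [H _] := dents ei; rewrite ei; exact: H.
pose C := \bigcup_(y in Y) closed_square y d.
have cC : closed C by apply: closed_bigcup_finite => // y _; exact: closed_closed_square.
have sqC y : Y y -> open_square y d `<=` C^°.
  by move=> Yy z /open_square_interior; apply: filterS => w; exists y.
have GC : G `<=` C^° by move=> x /GY[y Yy /(sqC _ Yy)].
(* [S1] holds the straight edges, [S2] the segments of [P] through the ends of dents, and [S3] one
   segment of [P] per square, for density. *)
have [S1 [fS1 S1P S1e]] := @finite_choice _ (plane R * plane R)%type
    [set i | exists p q, e i = Segment p q] (fun i s => e i = Segment s.1 s.2)
    finite_finset (ltac:(by move=> i [p [q ei]]; exists (p, q))).
have [S2 [fS2 S2P S2e]] := @finite_choice _ (plane R * plane R)%type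
    (\bigcup_(i in isarc) edge_ends r (e i))
    (fun v s => [/\ s.1 <> s.2, segment s.1 s.2 v & segment s.1 s.2 `<=` P])
    (ltac:(by apply: bigcup_finite => [|i _]; [exact: finite_finset|case: (e i) => *; exact: finite_set2]))
    (ltac:(by move=> v [i [c [a [b ei]]] iv]; have [p [q H]] := touching_segment ei iv; exists (p, q))).
have [S3 [fS3 S3P S3e]] := @finite_choice _ (plane R * plane R)%type Y
    (fun y s => [/\ s.1 <> s.2, segment s.1 s.2 `<=` P & segment s.1 s.2 `<=` open_square y d])
    fY (fun y Yy => small_segment (Gint _ (YG _ Yy)) d0).
pose S := S1 `|` S2 `|` S3.
have fS : finite_set S by rewrite !finite_setU.
have SP s : S s -> s.1 <> s.2 /\ segment s.1 s.2 `<=` P.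
  move=> [[/S1P[i _ ei]|/S2P[v _ []//]]|/S3P[y _ []//]].
  by split; [have := nondeg i; rewrite ei|have := @edge_in_region i; rewrite ei].
pose O := P^° `\` C.
have oO : open O by rewrite /O setDE; apply: openI; [exact: open_interior|exact: closed_openC].
pose X := closure O `|` \bigcup_(s in S) segment s.1 s.2.
have XP : X `<=` P.
  move=> x [cx|[s /SP[_ sP]]]; last exact: sP.
  by apply: cP; apply: closure_subset cx => y [/interior_subset].
have segX i p q : e i = Segment p q -> segment p q `<=` X.
  move=> ei x sx; have [s Ss es] := S1e i (ltac:(by exists p, q)).
  by right; exists s; [left; left|move: es; rewrite ei => -[<- <-]].
have endX i c a b : e i = Arc c a b -> edge_ends r (e i) `<=` X.
  move=> ei x ix; have [|s Ss [_ sx _]] := S2e x.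
    by exists i => //; exists c, a, b.
  by right; exists s => //; left; right.
have OX x : P^° x -> ~ C x -> X^° x.
  move=> Px nC; have : nbhs x O by apply: open_nbhs_nbhs.
  by apply: filterS => y Oy; left; exact: subset_closure.
have bdP x : P x -> ~ C x -> (\bigcup_(s in S) segment s.1 s.2) x \/ X^° x.
  move=> Px nC; have [ix|] := in_interior_or_boundary cP Px; first by right; exact: OX.
  rewrite bP => -[i _]; case ei : (e i) => [p q|c a b] ix.
    have [s Ss es] := S1e i (ltac:(by exists p, q)).
    by left; exists s; [left; left|move: es; rewrite ei => -[<- <-]].
  exfalso; apply: nC; apply: interior_subset; apply: GC.
  by exists i; [exists c, a, b|rewrite ei].
have bX x : boundary X x ->
   (\bigcup_(s in S) segment s.1 s.2) x \/ exists2 y, Y y & closed_square y d x /\ ~ open_square y d x.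
  move=> bx; have cX : closed X.
    apply: closedU; first exact: closed_closure.
    by apply: closed_bigcup_finite => // s _; exact: closed_segment.
  have Xx := boundary_closed cX bx; case: (Xx) => [cx|]; last by left.
  (* A point of [closure O] cannot be in an open square, which is in the interior of [C]; so inside
     [C] it is on the side of a square. *)
  have [[y Yy yx]|nC] := pselect (C x).
    right; exists y => //; split=> // /(sqC _ Yy) iC.
    have [z [[_ nC] Cz]] := cx _ (open_nbhs_nbhs (conj (@open_interior _ C) iC)).
    by apply: nC; exact: interior_subset.
  by have [|ix] := bdP x (XP _ Xx) nC; [left|case: bx].
exists X; split=> //.
- apply: (@polygonal_of_lines _ O S (\bigcup_(y in Y) square_sides y d)) => //.
  + by move=> s /SP[].
  + apply: bigcup_finite => // y _.
    by rewrite /square_sides finite_setU; split; exact: finite_set2.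
  + move=> k [y _ [[->|->]|[->|->]]]; (split; last by do 2 eexists);
      by rewrite /= expr0n expr1n /= ?addr0 ?add0r oner_neq0.
  + move=> x /bX[|[y Yy [cy ny]]]; [by left|right].
    by have [k sk kx] := square_sidesP 1 cy ny; exists k => //; exists y.
  (* [P] may be unbounded, but the boundary of [X] is in finitely many segments and squares. *)
  + have [m m0 mB] : exists2 m : R, 0 <= m & forall x,
        (\bigcup_(s in S) segment s.1 s.2 `|` C) x -> `|x.1| <= m /\ `|x.2| <= m.
      apply: compact_plane_bounded; apply: compactU; apply: compact_bigcup_finite => // *.
        exact: compact_segment.
      exact: compact_closed_square.
    exists m => // x /bX[sx|[y Yy [cy _]]]; apply: mB; [by left|by right; exists y].
- apply: offset_dense_subset => // x Px.
  have [[y Yy [x1 x2]]|nC] := pselect (C x); last first.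
    exists x; last by rewrite /distsq !subrr expr0n /= addr0 sqr_ge0.
    by have [sx|/interior_subset//] := bdP x Px nC; right.
  have [s Ss [_ _ ssq]] := S3e y Yy.
  have [y1 y2] := ssq _ (segment_left s.1 s.2).
  exists s.1; first by right; exists s; [right|exact: segment_left].
  have -> : rho - r = (d *+ 2) *+ 2 by rewrite /d !mulr2n; lra.
  apply: distsq_near.
    have := ler_distD y.1 x.1 s.1.1; rewrite (distrC y.1) mulr2n; lra.
  have := ler_distD y.2 x.2 s.1.2; rewrite (distrC y.2) mulr2n; lra.
Qed.

End IndentedRegion.

Theorem theorem5 (R : realType) (P : set (R * R)) (r1 r2 : R)
    (hr1 : 0 < r1) (hP : indented_region r1 P) (hr2 : r1 < r2) :
  (exists PL : set (R * R),
     [/\ polygonal_region PL, PL `<=` P & offset P r2 = offset PL r2]) /\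
  bulged_region r2 (offset P r2).
Proof.
case: hP => cP [n [e [nondeg bP meet dents]]]; split.
  exact: (polygonal_core hr1 cP nondeg bP meet dents).
exact: (offset_bulged hr1 cP nondeg bP meet dents).
Qed.
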